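(* Assume $\|X\|/p\le\lambda\le 2\bar\lambda$ with $\bar\lambda=2\|X\|\sqrt{\log p}$, and that there are constants $A_1,A_2,A_3,A_4>0$ (not depending on $p$) such that $A_1p^{-A_3}\pi_p(s-1)\le\pi_p(s)\le A_2p^{-A_4}\pi_p(s-1)$ for $s=1,\dots,p$. Then for any $M>2$, \[ \sup_{\beta^0,\beta^*\in\mathbb R^p}\mathbb E_{\beta^0}\Pi\Big(\beta:|S_\beta|>|S_*|+\frac M{A_4}\Big(1+\frac{16}{\phi(S_* )^2}\frac\lambda{\bar\lambda}\Big)|S_*|+\frac M{A_4}\frac{\|X(\beta^0-\beta^* )\|_2^2}{\log p}\ \Big|\ Y\Big)\to0 \] as $n,p\to\infty$, where $S_*=S_{\beta^*}$.
   Context: Observations follow $Y=X\beta+\varepsilon$ with $X$ a deterministic real $n\times p$ matrix and $\varepsilon\sim N_n(0,I_n)$; $\mathbb E_{\beta^0}$ is expectation when $Y\sim N_n(X\beta^0,I_n)$. $S_\beta=\{i:\beta_i\ne0\}$, $\beta_S=(\beta_i)_{i\in S}$, $\|X\|=\max_i\|X_{\cdot,i}\|_2$. Prior $\Pi$: draw $s\sim\pi_p$ on $\{0,\dots,p\}$, then $S$ uniform among subsets of size $s$, then $\beta_i$, $i\in S$, i.i.d. with density $\frac\lambda2e^{-\lambda|x|}$, $\beta_i=0$ for $i\notin S$. Posterior $\Pi(B\mid Y)=\int_Be^{-\|Y-X\beta\|_2^2/2}d\Pi(\beta)/\int e^{-\|Y-X\beta\|_2^2/2}d\Pi(\beta)$.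 $\phi(S)=\inf\{\|X\beta\|_2|S|^{1/2}/(\|X\|\|\beta_S\|_1):\|\beta_{S^c}\|_1\le7\|\beta_S\|_1,\beta_S\ne0\}$. Asymptotics: $n,p\to\infty$ with $X,\lambda,\pi_p$ depending on $n,p$ subject to the assumptions (constants $A_i$ fixed). *)

(* Defs.v *)
From HB Require Import structures.
From mathcomp Require Import all_boot all_order all_algebra.
From mathcomp Require Import all_classical all_reals all_analysis.
Set Implicit Arguments. Unset Strict Implicit. Unset Printing Implicit Defensive.
Import Order.TTheory GRing.Theory Num.Theory.
Import numFieldNormedType.Exports.
Local Open Scope classical_set_scope.
Local Open Scope ring_scope.

Section Defs.
Variable R : realType.

Definition sqnorm2 m (v : 'cV[R]_m) : R := \sum_(j < m) (v j 0) ^+ 2.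

Definition colnorm n p (X : 'M[R]_(n, p)) : R :=
  \big[Num.max/0]_(i < p) Num.sqrt (\sum_(j < n) (X j i) ^+ 2).

Definition supp p (b : 'cV[R]_p) : {set 'I_p} := [set i | b i 0 != 0].

Definition l1on p (S : {set 'I_p}) (b : 'cV[R]_p) : R := \sum_(i in S) `|b i 0|.

(* compatibility constant phi(S), an extended real (inf of empty set = +oo) *)
Definition phiS n p (X : 'M[R]_(n, p)) (S : {set 'I_p}) : \bar R :=
  ereal_inf [set ((Num.sqrt (sqnorm2 (X *m b)) * Num.sqrt (#|S|%:R)
                  / (colnorm X * l1on S b))%:E)%E
            | b in [set b : 'cV[R]_p | l1on (~: S) b <= 7 * l1on S b /\
                                       [exists i in S, b i 0 != 0]]].

Definition phi_inv2 (f : \bar R) : \bar R :=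
  match f with
  | r%:E => if r == 0 then +oo%E else ((r ^+ 2)^-1)%:E
  | +oo%E => 0%E
  | -oo%E => +oo%E
  end.

Definition setc m (b : 'cV[R]_m) (i : 'I_m) (x : R) : 'cV[R]_m :=
  \col_j (if j == i then x else b j 0).

Fixpoint iterInt m (s : seq 'I_m) (g : 'cV[R]_m -> \bar R) (b : 'cV[R]_m) : \bar R :=
  match s with
  | [::] => g b
  | i :: s' => (\int[lebesgue_measure]_(x in setT) iterInt s' g (setc b i x))%E
  end.

(* integral over R^m (via Tonelli, an iterated integral) *)
Definition intRm m (g : 'cV[R]_m -> \bar R) : \bar R := iterInt (enum 'I_m) g 0.

Definition laplace_dens (lam x : R) : R := lam / 2 * expR (- (lam * `|x|)).
Definition gauss_dens (x : R) : R := (Num.sqrt (2 * pi))^-1 * expR (- (x ^+ 2) / 2).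

(* \int f dPi for the spike-and-slab Laplace prior with dimension prior pi *)
Definition prior_int p (lam : R) (pi : nat -> R) (f : 'cV[R]_p -> \bar R) : \bar R :=
  (\sum_(S : {set 'I_p})
     ((pi #|S| / ('C(p, #|S|))%:R)%:E *
      iterInt (enum S) (fun b => f b * (\prod_(i in S) laplace_dens lam (b i 0))%:E) 0))%E.

Definition posterior n p (X : 'M[R]_(n, p)) (lam : R) (pi : nat -> R)
    (B : set 'cV[R]_p) (Y : 'cV[R]_n) : \bar R :=
  let lik := fun b : 'cV[R]_p => (expR (- (sqnorm2 (Y - X *m b)) / 2))%:E in
  (prior_int lam pi (fun b => (\1_B b)%:E * lik b) * (prior_int lam pi lik)^-1)%E.

Definition expect n p (X : 'M[R]_(n, p)) (b0 : 'cV[R]_p) (g : 'cV[R]_n -> \bar R) : \bar R :=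
  intRm (fun e : 'cV[R]_n =>
    let y : 'cV[R]_n := (X *m b0 + e)%R in (g y * (\prod_(j < n) gauss_dens (e j 0))%:E)%E).

Definition lambar n p (X : 'M[R]_(n, p)) : R := 2 * colnorm X * Num.sqrt (ln p%:R).

Definition event n p (X : 'M[R]_(n, p)) (lam M A4 : R) (b0 bs : 'cV[R]_p)
  : set 'cV[R]_p :=
  let Ss := supp bs in
  let thr : \bar R :=
    ((#|Ss|%:R)%:E
     + (M / A4 * #|Ss|%:R)%:E
         * (1%:E + (16 * (lam / lambar X))%:E * phi_inv2 (phiS X Ss))
     + (M / A4 * sqnorm2 (X *m (b0 - bs)) / ln p%:R)%:E)%E in
  [set b | (thr < (#|supp b|%:R)%:E)%E].

End Defs.

(* Main.v *)
(** Write [d = X (b0 - bs)], [L = ln p] and [a = lam / (2 lambar)], so [0 < a <= 1].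
    The normalising constant of the posterior is bounded below by keeping only the
    slab [supp bs] and, in it, a small box with one corner at [bs] on which the score
    at [bs] is nonnegative; this costs a factor [(2 e p ^ 2) ^ #|supp bs|].

    Off the event that some [X_i . e] exceeds [lambar] (probability at most [2 / p]),
    the part [a (e . X (b - bs))] of the linear term of the log-likelihood is absorbed
    by the Laplace prior, and the rest is integrated out exactly under the law with
    mean [X bs].  Only the fraction [a] of [d . X (b - bs)] then remains, which is why
    the bias enters the exponent as [a |d|^2], not as [|d|^2 / a].  The passage from mean
    [X b0] to mean [X bs] uses, for a threshold [kap] on the ratio of the two Gaussian
    densities, that the posterior is at most [1] and that the second moment of the
    ratio is [exp |d|^2].

    Compatibility bounds the exponent by [a (49 #|supp bs| L / phi ^ 2 + |d|^2)]
    minus a multiple of the l1 distance, integrable on each slab.  The prior ratio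
    [p ^ (- A4 (s - #|supp bs|))] beats this for dimensions [s] above the threshold
    because [49 < 32 M] and [M > 2]. *)

Require Import Defs.
From HB Require Import structures.
From mathcomp Require Import all_boot all_order all_algebra.
From mathcomp Require Import all_classical all_reals all_analysis.
From mathcomp Require Import measurable_realfun ring lra.
Import Order.TTheory GRing.Theory Num.Theory.
Import numFieldNormedType.Exports.
Local Open Scope classical_set_scope.
Local Open Scope ring_scope.
Set Implicit Arguments.
Unset Strict Implicit.
Unset Printing Implicit Defensive.

(** * Iterated Lebesgue integrals *)

Lemma measurable_EFin_comp (R : realType) (f : R -> R) (D : set R) :
  measurable_fun D f -> measurable_fun D (fun x => (f x)%:E).
Proof. by move=> mf; apply: (@measurableT_comp _ _ _ _ _ _ EFin D f). Qed.
Section IteratedIntegrals.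
Variable R : realType.
Local Notation mu := (@lebesgue_measure R).

(* Unlike [ge0_le_integral], no measurability is required. *)
Lemma le_integral_ge0 (f g : R -> \bar R) :
  (forall x, 0 <= f x)%E -> (forall x, f x <= g x)%E ->
  (\int[mu]_x f x <= \int[mu]_x g x)%E.
Proof.
move=> f0 fg; rewrite !ge0_integralTE//; last first.
  by move=> x; exact: le_trans (fg x).
(* The integral of a nonnegative function is a supremum over the simple functions below it, and a
   larger integrand admits more of them. *)
by apply: ereal_sup_le => _ [h hf <-]; exists h => // x; exact: le_trans (fg x).
Qed.

(** The vectors at which [iterInt s g b] evaluates [g]. For the slab of [S], where the start is [0],
    they are the vectors supported in [S]. *)
Definition agree_off m (s : seq 'I_m) (b b' : 'cV[R]_m) :=
  forall i, i \notin s -> b' i 0 = b i 0.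

Lemma setc_same m (b : 'cV[R]_m) i x : setc b i x i 0 = x.
Proof. by rewrite mxE eqxx. Qed.

Lemma agree_off_setc m (s : seq 'I_m) i x (b b' : 'cV[R]_m) :
  agree_off s (setc b i x) b' -> agree_off (i :: s) b b'.
Proof.
by move=> h j; rewrite inE negb_or => /andP[ji js]; rewrite h// mxE (negPf ji).
Qed.

(** Nonnegativity is part of the conclusion because each further integration needs it of the inner
    integral. No measurability enters, so indicators of arbitrary sets are covered. *)
Lemma iterInt_le_off m (s : seq 'I_m) (g g' : 'cV[R]_m -> \bar R) b :
  (forall b', agree_off s b b' -> (0 <= g b')%E && (g b' <= g' b')%E) ->
  (0 <= iterInt s g b)%E && (iterInt s g b <= iterInt s g' b)%E.
Proof.
elim: s b => [|i s IH] b gg' /=; first exact: gg'.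
have H x := IH (setc b i x) (fun b' h => gg' b' (agree_off_setc h)).
apply/andP; split.
  by apply: integral_ge0 => x _; have /andP[] := H x.
by apply: le_integral_ge0 => x; have /andP[] := H x.
Qed.

Lemma iterInt_ge0 m (s : seq 'I_m) (g : 'cV[R]_m -> \bar R) b :
  (forall b, 0 <= g b)%E -> (0 <= iterInt s g b)%E.
Proof.
move=> g0; have/andP[//] : (0 <= iterInt s g b)%E && (iterInt s g b <= iterInt s g b)%E.
by apply: iterInt_le_off => b' _; rewrite g0/=.
Qed.

Lemma iterInt_le m (s : seq 'I_m) (g g' : 'cV[R]_m -> \bar R) b :
  (forall b, 0 <= g b)%E -> (forall b, g b <= g' b)%E ->
  (iterInt s g b <= iterInt s g' b)%E.
Proof.
move=> g0 gg; have/andP[//] : (0 <= iterInt s g b)%E && (iterInt s g b <= iterInt s g' b)%E.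
by apply: iterInt_le_off => b' _; rewrite g0 gg.
Qed.

Lemma iterInt_eq_off m (s : seq 'I_m) (g g' : 'cV[R]_m -> \bar R) b :
  (forall b', agree_off s b b' -> g b' = g' b') ->
  iterInt s g b = iterInt s g' b.
Proof.
elim: s b => [|i s IH] b gg' /=; first exact: gg'.
by apply: eq_integral => x _; apply: IH => b' /agree_off_setc; exact: gg'.
Qed.

(* The library puts no sigma-algebra on ['cV[R]_m]: a function on it counts as
   measurable when its composite with every coordinatewise measurable family of
   vectors, indexed by any measurable space, is measurable. *)
Definition plot d (U : measurableType d) m (be : U -> 'cV[R]_m) :=
  forall i, measurable_fun setT (fun u => be u i 0).

Lemma plot_setc d (U : measurableType d) m (be : U -> 'cV[R]_m) i (x : U -> R) :
  plot be -> measurable_fun setT x -> plot (fun u => setc (be u) i (x u)).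
Proof.
move=> pb mx j; case: (eqVneq j i) => [->|ji].
  by apply: eq_measurable_fun mx => u _; rewrite setc_same.
by apply: eq_measurable_fun (pb j) => u _; rewrite mxE (negPf ji).
Qed.

(** The parameter [u] stands for variables integrated outside the vector integral. *)
Definition jmeas d (U : measurableType d) m (G : U -> 'cV[R]_m -> \bar R) :=
  forall d' (V : measurableType d') (ta : V -> U) (be : V -> 'cV[R]_m),
    measurable_fun setT ta -> plot be ->
    measurable_fun setT (fun v => G (ta v) (be v)).

(** Each integration is the measurability half of Tonelli on [V * R]; quantifying over all families
    [ta], [be] lets the induction hypothesis be applied on that product. *)
Lemma iterInt_jmeas d (U : measurableType d) m (s : seq 'I_m)
    (G : U -> 'cV[R]_m -> \bar R) :
  (forall u b, 0 <= G u b)%E -> jmeas G ->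
  jmeas (fun u => iterInt s (G u)).
Proof.
move=> G0 mG; elim: s => [|i s IH] d' V ta be mta pbe /=; first exact: mG.
pose f (vx : V * R) := iterInt s (G (ta vx.1)) (setc (be vx.1) i vx.2).
have mf : measurable_fun setT f.
  apply: (IH _ _ (ta \o fst) (fun vx => setc (be vx.1) i vx.2)).
    exact: measurableT_comp.
  by apply: plot_setc => // j; apply: (measurableT_comp (pbe j)).
apply: (@measurable_fun_fubini_tonelli_F _ _ _ _ _ mu f mf).
by move=> ?; apply: iterInt_ge0.
Qed.

Lemma integral_iterInt m (s : seq 'I_m) (G : R -> 'cV[R]_m -> \bar R) b :
  (forall u b, 0 <= G u b)%E -> jmeas G ->
  (\int[mu]_x iterInt s (G x) b)%E =
  iterInt s (fun b' => \int[mu]_x G x b')%E b.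
Proof.
move=> G0 mG; elim: s b => [//|i s IH] b /=.
pose f (vx : R * R) := iterInt s (G vx.1) (setc b i vx.2).
rewrite (@fubini_tonelli _ _ _ _ _ mu mu f)//.
- by apply: eq_integral => y _; rewrite -IH.
- apply: (@iterInt_jmeas _ _ _ s G G0 mG _ _ fst (fun vx => setc b i vx.2)) => //.
  by apply: plot_setc => // j; exact: measurable_cst.
- by move=> ?; apply: iterInt_ge0.
Qed.

Definition jmeas2 n m (H : 'cV[R]_n -> 'cV[R]_m -> \bar R) :=
  forall d (V : measurableType d) (al : V -> 'cV[R]_n) (be : V -> 'cV[R]_m),
    plot al -> plot be -> measurable_fun setT (fun v => H (al v) (be v)).

(** Tonelli, one pair of coordinates at a time. It lets the noise be integrated before the
    parameter. *)
Lemma iterInt_swap n m (s : seq 'I_n) (t : seq 'I_m)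
    (H : 'cV[R]_n -> 'cV[R]_m -> \bar R) e0 b0 :
  (forall e b, 0 <= H e b)%E -> jmeas2 H ->
  iterInt s (fun e => iterInt t (H e) b0) e0 =
  iterInt t (fun b => iterInt s (H^~ b) e0) b0.
Proof.
move=> H0 mH; elim: s e0 => [//|j s IH] e0 /=.
under eq_integral do rewrite IH.
apply: integral_iterInt => [u b|d V ta be mta pbe]; first exact: iterInt_ge0.
apply: (@iterInt_jmeas _ V _ s (fun v e => H e (be v)) _ _ _ V id
  (fun v => setc e0 j (ta v))) => //.
- move=> d' W tw ga mtw pga; apply: mH => // i.
  exact: (measurableT_comp (pbe i)).
- by apply: plot_setc => // i; exact: measurable_cst.
Qed.

Definition cmeas m (g : 'cV[R]_m -> \bar R) :=
  forall d (V : measurableType d) (be : V -> 'cV[R]_m),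
    plot be -> measurable_fun setT (fun v => g (be v)).

Lemma cmeas_slice m (s : seq 'I_m) (g : 'cV[R]_m -> \bar R) b i :
  (forall b, 0 <= g b)%E -> cmeas g ->
  measurable_fun setT (fun x : R => iterInt s g (setc b i x)).
Proof.
move=> g0 mg; apply: (@iterInt_jmeas _ R _ s (fun=> g) _ _ _ _ id (setc b i)) => //.
- by move=> d' V ta be _; exact: mg.
- by apply: (@plot_setc _ _ _ (fun=> b)) => // j; exact: measurable_cst.
Qed.

Lemma iterInt_sum m (s : seq 'I_m) (I : Type) (r : seq I)
    (f : I -> 'cV[R]_m -> \bar R) b :
  (forall k b, 0 <= f k b)%E -> (forall k, cmeas (f k)) ->
  iterInt s (fun b' => \sum_(k <- r) f k b')%E b =
  (\sum_(k <- r) iterInt s (f k) b)%E.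
Proof.
move=> f0 mf; elim: s b => [//|i s IH] b /=.
under eq_integral do rewrite IH.
rewrite ge0_integral_sum// => [k|k x _]; first exact: cmeas_slice.
exact: iterInt_ge0.
Qed.

Lemma iterIntD m (s : seq 'I_m) (f g : 'cV[R]_m -> \bar R) b :
  (forall b, 0 <= f b)%E -> (forall b, 0 <= g b)%E -> cmeas f -> cmeas g ->
  iterInt s (fun b' => f b' + g b')%E b = (iterInt s f b + iterInt s g b)%E.
Proof.
move=> f0 g0 mf mg; elim: s b => [//|i s IH] b /=.
under eq_integral do rewrite IH.
by rewrite ge0_integralD// => [x _||x _|]; [exact: iterInt_ge0|exact: cmeas_slice|
  exact: iterInt_ge0|exact: cmeas_slice].
Qed.

Lemma iterIntZl m (s : seq 'I_m) (f : 'cV[R]_m -> \bar R) (c : \bar R) b :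
  (forall b, 0 <= f b)%E -> cmeas f -> (0 <= c)%E ->
  iterInt s (fun b' => c * f b')%E b = (c * iterInt s f b)%E.
Proof.
move=> f0 mf c0; elim: s b => [//|i s IH] b /=.
under eq_integral do rewrite IH.
rewrite ge0_integralZl// => [|x _]; first exact: cmeas_slice.
exact: iterInt_ge0.
Qed.

(** The constant [c] is kept general so that the induction can freeze into it the factor of the
    outermost coordinate. *)
Lemma iterInt_prod m (s : seq 'I_m) (f : 'I_m -> R -> R) (v : 'I_m -> R) c b :
  uniq s -> 0 <= c -> (forall i x, 0 <= f i x) ->
  (forall i, measurable_fun setT (f i)) ->
  (forall i, \int[mu]_x (f i x)%:E = (v i)%:E)%E ->
  iterInt s (fun b' => (c * \prod_(i <- s) f i (b' i 0))%:E) b =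
  (c * \prod_(i <- s) v i)%:E.
Proof.
move=> us c0 f0 mf fv; elim: s us c c0 b => [_ c _ b|i s IH /= /andP[nis us] c c0 b].
  by rewrite /= !big_nil.
transitivity (\int[mu]_x ((c * \prod_(k <- s) v k)%:E * (f i x)%:E))%E.
  apply: eq_integral => x _; rewrite -EFinM mulrAC -(IH us _ _ (setc b i x)) ?mulr_ge0//.
  apply: iterInt_eq_off => b' hb'; rewrite big_cons hb'// setc_same.
  by rewrite mulrA.
have v0 k : 0 <= v k.
  by rewrite -lee_fin -fv; apply: integral_ge0 => x _; rewrite lee_fin.
rewrite ge0_integralZl//.
- by rewrite fv -EFinM big_cons; congr (_%:E); ring.
- exact: measurable_EFin_comp.
- by move=> x _; rewrite lee_fin.
- by rewrite lee_fin mulr_ge0// prodr_ge0.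
Qed.

End IteratedIntegrals.

(** * One-dimensional integrals *)

Section OneDimensionalIntegrals.
Variable R : realType.
Local Notation mu := (@lebesgue_measure R).

Lemma continuous_laplace (c : R) : continuous (fun x : R => expR (- (c * `|x|))).
Proof.
move=> x; apply: continuous_comp; last exact: continuous_expR.
by apply: continuousN; apply: continuousM; [exact: cvg_cst|exact: norm_continuous].
Qed.

Lemma integral_laplace0 (c : R) : 0 < c ->
  (\int[mu]_x (expR (- (c * `|x|)))%:E = (2 / c)%:E)%E.
Proof.
move=> c0; rewrite ge0_symfun_integralT.
- have := integral_exponential_pdf c0.
  have -> : (fun x : R => (exponential_pdf c x)%:E) =
     ((fun x => (c * expR (- (c * `|x|)))%:E) \_ `[0%R, +oo[)%E.
    apply/funext => x; rewrite /exponential_pdf !patchE.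
    case: ifPn => // /[!inE]; rewrite /= in_itv/= andbT => x0.
    by rewrite ger0_norm// mulNr.
  rewrite -integral_mkcond.
  under eq_integral do rewrite EFinM.
  rewrite ge0_integralZl//=; last 2 first.
  - apply/measurable_EFinP/measurable_funTS.
    by apply: continuous_measurable_fun; exact: continuous_laplace.
  - by rewrite lee_fin ltW.
  have -> : [set x : R | 0 <= x] = `[0, +oo[%classic.
    by apply/seteqP; split => x /=; rewrite in_itv/= andbT.
  move=> h; rewrite EFinM muleC -[X in (_ * X)%E]mul1e.
  set I := (\int[_]_(_ in _) _)%E in h *.
  have -> : I = ((c^-1)%:E * (c%:E * I))%E.
    by rewrite muleA -EFinM mulVf ?gt_eqF// mul1e.
  by rewrite h mule1 mul1e muleC.
- by move=> x; exact: expR_ge0.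
- exact: continuous_laplace.
- by move=> x /=; rewrite normrN.
Qed.

Lemma integral_shift (G : R -> R) (m : R) : continuous G -> (forall x, 0 <= G x) ->
  (\int[mu]_x (G x)%:E = \int[mu]_x (G (x - m))%:E)%E.
Proof.
move=> cG G0.
have dF : (fun x : R => x - m)^`()%classic = cst 1.
  by apply/funext => x; rewrite derive1E deriveB// derive_id derive_cst subr0.
rewrite (@increasing_ge0_integration_by_substitutionT _ (fun x => x - m))//.
- by apply: eq_integral => x _; rewrite /= dF /= mulr1.
- by move=> x y xy; rewrite ltrD2r.
- by rewrite dF; exact: cst_continuous.
- by rewrite dF; exact: is_cvg_cst.
- by rewrite dF; exact: is_cvg_cst.
- by apply: cvg_addrr_Ny.
- by apply: cvg_addrr.
Qed.

Lemma integral_laplace (c b : R) : 0 < c ->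
  (\int[mu]_x (expR (- (c * `|x - b|)))%:E = (2 / c)%:E)%E.
Proof.
move=> c0; rewrite -(integral_laplace0 c0).
by rewrite [RHS](@integral_shift (fun x => expR (- (c * `|x|))) b)// =>
  ?; exact: continuous_laplace.
Qed.

Lemma gauss_densE (x : R) : gauss_dens x = normal_pdf 0 1 x.
Proof.
rewrite /gauss_dens /normal_pdf oner_eq0 /normal_peak /normal_fun subr0 expr1n.
by rewrite mul1r mulr_natl.
Qed.

Lemma gauss_dens_ge0 (x : R) : 0 <= gauss_dens x.
Proof. by rewrite mulr_ge0 ?expR_ge0// invr_ge0 sqrtr_ge0. Qed.

Lemma gauss_dens_gt0 (x : R) : 0 < gauss_dens x.
Proof.
by rewrite mulr_gt0 ?expR_gt0// invr_gt0 sqrtr_gt0 mulr_gt0// pi_gt0.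
Qed.

(** Completing the square: the integrand is [expR (u ^+ 2 / 2)] times the normal density with mean
    [u - d]. *)
Lemma integral_gauss_tilt (d u : R) :
  (\int[mu]_x (gauss_dens (x + d) * expR (u * (x + d)))%:E
   = (expR (u ^+ 2 / 2))%:E)%E.
Proof.
transitivity (\int[mu]_x ((expR (u ^+ 2 / 2))%:E * (normal_pdf (u - d) 1 x)%:E))%E.
  apply: eq_integral => x _; rewrite -EFinM; congr _%:E.
  rewrite gauss_densE /normal_pdf oner_eq0 /normal_peak /normal_fun.
  rewrite -mulrA [RHS]mulrCA -!expRD; congr (_ * expR _); by field.
rewrite ge0_integralZl//.
- by rewrite integral_normal_pdf mule1.
- apply: measurable_EFin_comp; exact: measurable_normal_pdf.
- by move=> x _; rewrite lee_fin normal_pdf_ge0.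
Qed.

Lemma integral_indic_itv (a b : R) : a <= b ->
  (\int[mu]_x (\1_`[a, b] x)%:E = (b - a)%:E)%E.
Proof.
move=> ab; rewrite integral_indic//= setIT lebesgue_measure_itv/= lte_fin.
by case: ltgtP ab => // -> _; rewrite subrr.
Qed.

End OneDimensionalIntegrals.

(** * Bounds on the exponent *)

Section RealBounds.
Variable R : realType.

Definition dot m (u v : 'cV[R]_m) := \sum_(j < m) u j 0 * v j 0.

Lemma sqnorm2_ge0 m (v : 'cV[R]_m) : 0 <= sqnorm2 v.
Proof. by apply: sumr_ge0 => j _; exact: sqr_ge0. Qed.

Lemma sqnorm2B m (u v : 'cV[R]_m) :
  sqnorm2 (u - v) = sqnorm2 u - 2 * dot u v + sqnorm2 v.
Proof.
rewrite /sqnorm2 /dot mulr_sumr -sumrB -big_split/=.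
by apply: eq_bigr => j _; rewrite !mxE; ring.
Qed.

Lemma dot_mulmx n p (X : 'M[R]_(n, p)) (e : 'cV[R]_n) (x : 'cV[R]_p) :
  dot e (X *m x) = \sum_i (\sum_j X j i * e j 0) * x i 0.
Proof.
rewrite /dot; under eq_bigr do rewrite mxE mulr_sumr.
rewrite exchange_big/=; apply: eq_bigr => i _.
by rewrite mulr_suml; apply: eq_bigr => j _; ring.
Qed.

Lemma dotDl m (u v w : 'cV[R]_m) : dot (u + v) w = dot u w + dot v w.
Proof. by rewrite /dot -big_split/=; apply: eq_bigr => j _; rewrite mxE mulrDl. Qed.

Lemma dot_young m (u v : 'cV[R]_m) : dot u v <= sqnorm2 u + sqnorm2 v / 4.
Proof.
rewrite /dot /sqnorm2 mulr_suml -big_split/=; apply: ler_sum => j _.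
rewrite -subr_ge0; have := sqr_ge0 (u j 0 - v j 0 / 2); congr (_ <= _); by field.
Qed.

(** Cauchy-Schwarz against the constant vector, obtained by summing
    [x i * x k <= x i ^+ 2 / 2 + x k ^+ 2 / 2] over all pairs. *)
Lemma sqr_sum_le (I : finType) (S : {set I}) (x : I -> R) :
  (\sum_(i in S) x i) ^+ 2 <= #|S|%:R * \sum_(i in S) x i ^+ 2.
Proof.
rewrite expr2 mulr_suml.
have -> : #|S|%:R * \sum_(i in S) x i ^+ 2 =
    \sum_(i in S) \sum_(k in S) (x i ^+ 2 / 2 + x k ^+ 2 / 2).
  under [RHS]eq_bigr do rewrite big_split/= sumr_const -mulr_suml.
  by rewrite big_split/= sumr_const sumrMnl -mulrnDl -mulr_suml -splitr mulr_natl.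
apply: ler_sum => i _; rewrite mulr_sumr; apply: ler_sum => k _.
by have := sqr_ge0 (x i - x k); rewrite sqrrB; lra.
Qed.

Lemma colnorm_ge0 n p (X : 'M[R]_(n, p)) : 0 <= colnorm X.
Proof. by rewrite /colnorm; elim/big_ind: _ => // x y x0 y0; rewrite le_max x0. Qed.

Lemma col_le_colnorm n p (X : 'M[R]_(n, p)) i : \sum_j X j i ^+ 2 <= colnorm X ^+ 2.
Proof.
have s0 : 0 <= \sum_j X j i ^+ 2 by apply: sumr_ge0 => j _; exact: sqr_ge0.
rewrite -(sqr_sqrtr s0) ler_sqr ?nnegrE ?sqrtr_ge0 ?colnorm_ge0//.
exact: (le_bigmax _ (fun i => Num.sqrt (\sum_j X j i ^+ 2))).
Qed.

Lemma sqnorm2_mulmx_le n p (X : 'M[R]_(n, p)) (S : {set 'I_p}) (x : 'cV[R]_p) r :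
  (forall i, i \in S -> `|x i 0| <= r) -> (forall i, i \notin S -> x i 0 = 0) ->
  sqnorm2 (X *m x) <= (r * #|S|%:R * colnorm X) ^+ 2.
Proof.
move=> xS x0.
have H j : ((X *m x) j 0) ^+ 2 <= #|S|%:R * \sum_(i in S) (X j i ^+ 2 * r ^+ 2).
  rewrite mxE (bigID (mem S))/= [X in _ + X]big1 ?addr0; last first.
    by move=> i iS; rewrite x0// mulr0.
  apply: (le_trans (sqr_sum_le _ _)); rewrite ler_wpM2l//; apply: ler_sum => i iS.
  rewrite exprMn ler_wpM2l ?sqr_ge0// -[leLHS]real_normK ?num_real//.
  by rewrite lerXn2r ?nnegrE ?xS// (le_trans _ (xS i iS)).
apply: (le_trans (ler_sum _ (fun j _ => H j))).
rewrite -mulr_sumr exchange_big/=.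
have -> : (r * #|S|%:R * colnorm X) ^+ 2 =
    #|S|%:R * \sum_(i in S) (colnorm X ^+ 2 * r ^+ 2).
  by rewrite sumr_const -mulr_natl; ring.
rewrite ler_wpM2l//; apply: ler_sum => i _.
by rewrite -mulr_suml ler_wpM2r ?sqr_ge0 ?col_le_colnorm.
Qed.

Lemma l1on_ge0 p (S : {set 'I_p}) (x : 'cV[R]_p) : 0 <= l1on S x.
Proof. exact: sumr_ge0. Qed.

Lemma sum_l1on p (S : {set 'I_p}) (x : 'cV[R]_p) :
  \sum_i `|x i 0| = l1on S x + l1on (~: S) x.
Proof.
rewrite (bigID (mem S))/=; congr (_ + _).
by apply: eq_bigl => i; rewrite inE.
Qed.

(** Here [u] is the square root of [ln p] and [f] is [1 / phi ^ 2]. With [P], [Q] the l1 distances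
    on and off the support and [T = |X (b - bs)|^2], the l1 terms together with the reserved
    [lam / 4] share are at most [lam / 4 * (7 P - Q)], which explains the cone constant 7.
    Compatibility costs [a T / 4] and the bias term another [a T / 4]; both are paid by
    [- T / 2 + (1 - a)^2 T / 2 <= - a T / 2]. *)
Lemma exponent_bound n p (X : 'M[R]_(n, p)) (d : 'cV[R]_n) (b bs : 'cV[R]_p)
    (lam a u f : R) :
  0 <= lam -> 0 <= a <= 1 -> 0 <= u -> lam = 4 * a * colnorm X * u -> 0 <= f ->
  (l1on (~: supp bs) (b - bs) <= 7 * l1on (supp bs) (b - bs) ->
   (colnorm X * l1on (supp bs) (b - bs)) ^+ 2
     <= f * #|supp bs|%:R * sqnorm2 (X *m (b - bs))) ->
  lam * (\sum_i `|bs i 0|) - lam * (\sum_i `|b i 0|)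
    + lam / 2 * (\sum_i `|(b - bs) i 0|)
    + a * dot d (X *m (b - bs)) - sqnorm2 (X *m (b - bs)) / 2
    + (1 - a) ^+ 2 * sqnorm2 (X *m (b - bs)) / 2
  <= - (lam / 4 * (\sum_i `|(b - bs) i 0|))
     + a * (49 * #|supp bs|%:R * u ^+ 2 * f + sqnorm2 d).
Proof.
move=> lam0 /andP[a0 a1] u0 lamE f0 compat.
set S := supp bs in compat *; set t := X *m (b - bs) in compat *.
set P := l1on S (b - bs) in compat *; set Q := l1on (~: S) (b - bs) in compat *.
set T := sqnorm2 t in compat *.
rewrite (sum_l1on S (b - bs)) -/P -/Q.
have P0 : 0 <= P by exact: l1on_ge0.
have Q0 : 0 <= Q by exact: l1on_ge0.
have T0 : 0 <= T by exact: sqnorm2_ge0.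
have hb : (\sum_i `|bs i 0|) - (\sum_i `|b i 0|) <= P - Q.
  rewrite (sum_l1on S bs) (sum_l1on S b).
  have -> : l1on (~: S) bs = 0.
    by apply: big1 => i; rewrite !inE negbK => /eqP ->; rewrite normr0.
  have -> : l1on (~: S) b = Q.
    apply: eq_bigr => i; rewrite !inE negbK => /eqP bi.
    by rewrite !mxE bi subr0.
  suff : l1on S bs <= l1on S b + P by lra.
  rewrite /l1on -big_split/=; apply: ler_sum => i _.
  have -> : bs i 0 = b i 0 - (b - bs) i 0 by rewrite !mxE; ring.
  exact: ler_normB.
have hc : 7 * lam * P <= lam * Q + a * (T + 4 * 49 * #|S|%:R * u ^+ 2 * f).
  (* Outside the cone [7 lam P] is already below [lam Q]; inside it the compatibility inequality
     applies. *)
  have [cone|/ltW ncone] := lerP Q (7 * P); last first.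
    apply: (@le_trans _ _ (lam * Q)).
      by rewrite mulrAC mulrC ler_wpM2l// mulrC [P * 7]mulrC.
    by rewrite lerDl !mulr_ge0// addr_ge0// !mulr_ge0// sqr_ge0.
  have {}compat := compat cone.
  suff : 28 * u * (colnorm X * P) <= T + 4 * 49 * #|S|%:R * u ^+ 2 * f.
    move=> /(ler_wpM2l a0) h; apply: (le_trans (_ : _ <= _ + 0 * Q)).
      by rewrite mul0r addr0; apply: le_refl.
    have : 0 <= lam * Q by rewrite mulr_ge0.
    by move: h; rewrite lamE; lra.
  rewrite -ler_sqr ?nnegrE; last 2 first.
    by rewrite !mulr_ge0// colnorm_ge0.
    by rewrite addr_ge0// !mulr_ge0// sqr_ge0.
  set B := 49 * #|S|%:R * u ^+ 2 * f.
  have -> : 4 * 49 * #|S|%:R * u ^+ 2 * f = 4 * B by rewrite /B; ring.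
  (* Compatibility bounds the square of the left side by [16 B T], and [16 B T <= (T + 4 B)^2] is
     the inequality of arithmetic and geometric means. *)
  apply: (@le_trans _ _ (16 * B * T)).
    rewrite exprMn /B.
    have -> : 16 * (49 * #|S|%:R * u ^+ 2 * f) * T =
      (28 * u) ^+ 2 * (f * #|S|%:R * T) by ring.
    by rewrite ler_wpM2l// sqr_ge0.
  by have := sqr_ge0 (T - 4 * B); rewrite !expr2; lra.
have hd : a * dot d t <= a * (sqnorm2 d + T / 4) by rewrite ler_wpM2l// dot_young.
have hT : (1 - a) ^+ 2 * T <= (1 - a) * T.
  by rewrite ler_wpM2r// expr2 ler_piMl//; lra.
have hl := ler_wpM2l lam0 hb.
lra.
Qed.

End RealBounds.

(** * The normalising constant *)

Section Denominator.
Variable R : realType.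
Local Notation mu := (@lebesgue_measure R).

(** Testing the infimum that defines [phiS] at [x] and squaring. If [x] vanishes on [S] it is not
    admissible, but then the left side is zero; otherwise [x] itself shows that the infimum is not
    [+oo]. *)
Lemma compat_phi n p (X : 'M[R]_(n, p)) (S : {set 'I_p}) (f : R) (x : 'cV[R]_p) :
  0 < colnorm X -> phi_inv2 (phiS X S) = f%:E ->
  l1on (~: S) x <= 7 * l1on S x ->
  (colnorm X * l1on S x) ^+ 2 <= f * #|S|%:R * sqnorm2 (X *m x).
Proof.
move=> c0 phif cone.
have f0 : 0 <= f.
  case: (phiS X S) phif => [r| |]//=.
    by case: ifPn => // _ [<-]; rewrite invr_ge0 sqr_ge0.
  by case=> <-.
have [P0|Pn0] := eqVneq (l1on S x) 0.
  by rewrite P0 mulr0 expr0n/= !mulr_ge0// sqnorm2_ge0.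
have P0 : 0 < l1on S x by rewrite lt_def Pn0 l1on_ge0.
set v := Num.sqrt (sqnorm2 (X *m x)) * Num.sqrt #|S|%:R / (colnorm X * l1on S x).
have phiv : (phiS X S <= v%:E)%E.
  apply: ge_ereal_inf; exists v%:E => //; exists x => //; split => //.
  apply: contraNT Pn0 => /existsPn h; apply/eqP; apply: big1 => i iS.
  by have := h i; rewrite iS/= negbK => /eqP ->; rewrite normr0.
have phi0 : (0 <= phiS X S)%E.
  apply: le_ereal_inf_tmp => _ [y _ <-]; rewrite lee_fin.
  by rewrite divr_ge0// mulr_ge0// ?sqrtr_ge0// ?colnorm_ge0 ?l1on_ge0.
case: (phiS X S) phiv phi0 phif => [r| |]//=; rewrite !lee_fin => rv r0.
case: ifPn => // rn0 [<-].
have {}r0 : 0 < r by rewrite lt_def rn0.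
move: rv; rewrite /v ler_pdivlMr ?mulr_gt0// => rv.
rewrite -mulrA [leRHS]mulrC ler_pdivlMr ?exprn_gt0//.
have -> : (colnorm X * l1on S x) ^+ 2 * r ^+ 2 = (r * (colnorm X * l1on S x)) ^+ 2 by ring.
apply: (@le_trans _ _ ((Num.sqrt (sqnorm2 (X *m x)) * Num.sqrt #|S|%:R) ^+ 2)).
  by rewrite ler_sqr// nnegrE ?mulr_ge0// ?sqrtr_ge0// ltW.
by rewrite exprMn !sqr_sqrtr ?sqnorm2_ge0// mulrC.
Qed.

Lemma laplace_dens_ge0 (lam x : R) : 0 <= lam -> 0 <= laplace_dens lam x.
Proof. by move=> l0; rewrite !mulr_ge0 ?expR_ge0. Qed.

(* The slab is cut down to the product of the intervals [J i], each lying on the side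
   of [bs i] where the linear term of the log-likelihood is nonnegative. *)
Lemma slab_lik_ge n p (X : 'M[R]_(n, p)) (Y : 'cV[R]_n) (bs : 'cV[R]_p) (lam r : R) :
  0 < lam -> 0 <= r ->
  r * #|supp bs|%:R * lam <= 1 -> r * #|supp bs|%:R * colnorm X <= 1 ->
  ((expR (- sqnorm2 (Y - X *m bs) / 2 - lam * (\sum_i `|bs i 0|) - 3 / 2)
     * (lam * r / 2) ^+ #|supp bs|)%:E <=
  iterInt (enum (supp bs)) (fun b => (expR (- sqnorm2 (Y - X *m b) / 2))%:E
     * (\prod_(i in supp bs) laplace_dens lam (b i 0))%:E) 0)%E.
Proof.
move=> lam0 r0 rlam rX; set S := supp bs.
set e := Y - X *m bs.
pose c i := \sum_j X j i * e j 0.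
pose J i := if 0 <= c i then `[bs i 0, bs i 0 + r] else `[bs i 0 - r, bs i 0].
pose f i (x : R) : R := \1_[set` J i] x.
pose C := expR (- sqnorm2 e / 2 - lam * (\sum_i `|bs i 0|) - 3 / 2) * (lam / 2) ^+ #|S|.
have C0 : 0 <= C by rewrite mulr_ge0 ?expR_ge0// exprn_ge0// divr_ge0// ltW.
have -> : expR (- sqnorm2 e / 2 - lam * (\sum_i `|bs i 0|) - 3 / 2)
    * (lam * r / 2) ^+ #|S| = C * \prod_(i <- enum S) r.
  rewrite big_const_seq count_predT -cardE iter_mulr_1 /C -[RHS]mulrA.
  by rewrite -exprMn (mulrAC lam r).
rewrite -(@iterInt_prod _ _ (enum S) f (fun=> r) C 0) ?enum_uniq//; last 2 first.
- by move=> i; exact: measurable_indic.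
- move=> i; rewrite /f /J; case: ifP => _.
    by rewrite integral_indic_itv ?lerDl// addrAC subrr add0r.
  by rewrite integral_indic_itv ?gerBl// opprB addrCA subrr addr0.
apply: (proj2 (andP (_ : (0 <= _)%E && _))).
apply: iterInt_le_off => b boff; rewrite -EFinM !lee_fin.
have pl0 : 0 <= \prod_(i in S) laplace_dens lam (b i 0).
  by apply: prodr_ge0 => i _; rewrite laplace_dens_ge0// ltW.
rewrite mulr_ge0//=; last by apply: prodr_ge0 => i _; rewrite /f indicE.
rewrite big_enum/=.
(* Off the box one indicator vanishes, and so does the lower bound. *)
have [/forallP bJ|/forallPn[i]] := boolP [forall i, (i \in S) ==> (b i 0 \in J i)]; last first.
  rewrite negb_imply => /andP[iS biJ].
  rewrite (bigD1 i)//= /f indicE memNset; last by apply/negP.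
  by rewrite mul0r mulr0 mulr_ge0// expR_ge0.
rewrite big1 ?mulr1; last first.
  by move=> i iS; rewrite /f indicE mem_set//; exact: (implyP (bJ i)).
have b0 i : i \notin S -> b i 0 = 0.
  by move=> iS; rewrite boff ?mem_enum// mxE.
have bs0 i : i \notin S -> bs i 0 = 0 by rewrite inE negbK => /eqP.
have dS i : i \in S -> `|(b - bs) i 0| <= r /\ 0 <= c i * (b - bs) i 0.
  move=> iS; have := implyP (bJ i) iS; rewrite /J !mxE; case: ifPn => [ci|].
    rewrite in_itv/= => /andP[h1 h2]; rewrite ger0_norm; last lra.
    split; first lra.
    by rewrite mulr_ge0//; lra.
  rewrite -ltNge => ci; rewrite in_itv/= => /andP[h1 h2]; rewrite ler0_norm; last lra.
  split; first lra.
  by rewrite mulr_le0 ?(ltW ci)//; lra.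
have nX : sqnorm2 (X *m (b - bs)) <= 1.
  apply: (@le_trans _ _ ((r * #|S|%:R * colnorm X) ^+ 2)).
    apply: sqnorm2_mulmx_le => i iS; first by have [] := dS i iS.
    by rewrite !mxE b0// bs0// subrr.
  by rewrite expr_le1// !mulr_ge0// colnorm_ge0.
have dX : 0 <= dot e (X *m (b - bs)).
  rewrite dot_mulmx; apply: sumr_ge0 => i _.
  have [iS|iS] := boolP (i \in S); first by have [] := dS i iS.
  by rewrite !mxE b0// bs0// subrr mulr0.
have eE : sqnorm2 (Y - X *m b) =
    sqnorm2 e - 2 * dot e (X *m (b - bs)) + sqnorm2 (X *m (b - bs)).
  by rewrite -sqnorm2B /e mulmxBr opprB addrA subrK.
(* The loss [3 / 2] is split: [1 / 2] pays for the quadratic term, at most 1 by [nX], and [1] for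
   the variation of the Laplace density over the box, where [r * #|S| * lam <= 1]. *)
have -> : C = expR (- sqnorm2 e / 2 - 1 / 2)
   * (\prod_(i in S) (lam / 2 * expR (- (lam * (`|bs i 0|))))  * expR (- 1)).
  rewrite big_split/= prodr_const -expR_sum sumrN -mulr_sumr /C.
  rewrite (sum_l1on S bs) [l1on (~: S) _]big1 ?addr0; last first.
    by move=> i; rewrite inE => iS; rewrite bs0// normr0.
  rewrite mulrC -mulrA mulrCA; congr (_ * _); rewrite -!expRD; congr expR.
  by rewrite /l1on; field.
apply: ler_pM; rewrite ?expR_ge0//.
- rewrite mulr_ge0 ?expR_ge0//; apply: prodr_ge0 => i _.
  by rewrite mulr_ge0 ?expR_ge0// divr_ge0// ltW.
- by rewrite ler_expR eE; lra.
apply: (@le_trans _ _ (\prod_(i in S)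
    (lam / 2 * expR (- (lam * (`|bs i 0|))) * expR (- (lam * r))))).
  rewrite [leRHS]big_split/= prodr_const -expRM_natl ler_pM2l; last first.
    by apply: prodr_gt0 => i _; rewrite mulr_gt0 ?expR_gt0// divr_gt0.
  rewrite ler_expR mulrN lerN2.
  by have -> : #|S|%:R * (lam * r) = r * #|S|%:R * lam by ring.
apply: ler_prod => i iS; rewrite !mulr_ge0 ?expR_ge0 ?invr_ge0 ?(ltW lam0)//=.
rewrite /laplace_dens -mulrA -expRD ler_pM2l ?divr_gt0// ler_expR.
rewrite -opprD lerN2 -mulrDr ler_pM2l//.
have [h _] := dS i iS.
have -> : b i 0 = bs i 0 + (b - bs) i 0 by rewrite !mxE; ring.
by apply: (le_trans (ler_normD _ _)); rewrite lerD2l.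
Qed.

End Denominator.

(** * Cost of the dimension prior and of the box in the lower bound *)

Section Evidence.
Variable R : realType.

Lemma ffact_le_exp m k : (m ^_ k <= m ^ k)%N.
Proof.
elim: k m => // k IH m; rewrite ffactnS expnS leq_mul//.
by apply: (leq_trans (IH _)); case: (k) => // k'; rewrite leq_exp2r ?leq_pred.
Qed.

(** Combines [C(p, s) s! <= p ^ s] with [s ^ s <= s! e ^ s], the latter from a single term of the
    exponential series at [s]. *)
Lemma bin_self_le (p s : nat) :
  'C(p, s)%:R * s%:R ^+ s <= (expR 1 * p%:R) ^+ s :> R.
Proof.
have ss : s%:R ^+ s <= s`!%:R * expR 1 ^+ s :> R.
  case: s => [|s]; first by rewrite !expr0 mulr1.
  have := @expR_ge1Dxn R s.+1%:R s (ler0n _ _).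
  rewrite -[X in expR X]mulr1 expRM_natl => h.
  rewrite mulrC -ler_pdivrMr ?ltr0n ?fact_gt0//.
  by apply: le_trans h; rewrite lerDr.
apply: (@le_trans _ _ ('C(p, s)%:R * (s`!%:R * expR 1 ^+ s))).
  by rewrite ler_wpM2l.
rewrite mulrA -natrM bin_ffact mulrC exprMn ler_wpM2l ?exprn_ge0 ?expR_ge0//.
by rewrite -natrX ler_nat ffact_le_exp.
Qed.

(** The right side is the uniform weight of one slab times the prior mass scale of a box of side
    [1 / (p s lam)]; the factor [s ^ s] lost in the box is regained from the binomial. *)
Lemma slab_weight_ge (p s : nat) : (s <= p)%N -> (0 < p)%N ->
  ((2 * expR 1 * p%:R ^+ 2)^-1) ^+ s <=
  ('C(p, s)%:R)^-1 * ((p%:R * s%:R)^-1 / 2) ^+ s :> R.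
Proof.
case: s => [|s] sp p0; first by rewrite !expr0 mulr1 bin0 invr1.
set c : R := 'C(p, s.+1)%:R; set x : R := s.+1%:R; set y : R := p%:R.
have x0 : 0 < x by rewrite ltr0n.
have y0 : 0 < y by rewrite ltr0n.
have c0 : 0 < c by rewrite ltr0n bin_gt0.
have -> : (y * x)^-1 / 2 = (2 * y * x)^-1 by field; rewrite !gt_eqF.
rewrite !exprVn -invfM lef_pV2 ?posrE ?mulr_gt0 ?exprn_gt0 ?mulr_gt0 ?expR_gt0 ?exprn_gt0//.
rewrite !exprMn; have := bin_self_le p s.+1; rewrite -/c -/x -/y exprMn => h.
have -> : c * (2 ^+ s.+1 * y ^+ s.+1 * x ^+ s.+1) =
  2 ^+ s.+1 * y ^+ s.+1 * (c * x ^+ s.+1) by ring.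
apply: (le_trans (ler_wpM2l _ h)); first by rewrite mulr_ge0// exprn_ge0// ltW.
by rewrite le_eqVlt; apply/orP; left; apply/eqP; ring.
Qed.

Lemma prior_int_ge_slab p (lam : R) (pi : nat -> R) (f : 'cV[R]_p -> \bar R) (S : {set 'I_p}) :
  0 <= lam -> (forall s, (s <= p)%N -> 0 <= pi s) -> (forall b, 0 <= f b)%E ->
  ((pi #|S| / ('C(p, #|S|))%:R)%:E *
      iterInt (enum S) (fun b => f b * (\prod_(i in S) laplace_dens lam (b i 0))%:E) 0
   <= prior_int lam pi f)%E.
Proof.
move=> lam0 pi0 f0; rewrite /prior_int (bigD1 S)//= leeDl//.
apply: sume_ge0 => U _; apply: mule_ge0.
  by rewrite lee_fin divr_ge0// pi0// -[X in (_ <= X)%N]card_ord max_card.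
apply: iterInt_ge0 => b; apply: mule_ge0 => //; rewrite lee_fin.
by apply: prodr_ge0 => i _; exact: laplace_dens_ge0.
Qed.

Lemma evidence_ge n p (X : 'M[R]_(n, p)) (Y : 'cV[R]_n) (bs : 'cV[R]_p) (lam : R)
    (pi : nat -> R) :
  0 < lam -> (0 < p)%N -> colnorm X / p%:R <= lam ->
  (forall s, (s <= p)%N -> 0 <= pi s) ->
  ((pi #|supp bs| * expR (- 3 / 2) * ((2 * expR 1 * p%:R ^+ 2)^-1) ^+ #|supp bs|
     * expR (- (lam * (\sum_i `|bs i 0|))) * expR (- sqnorm2 (Y - X *m bs) / 2))%:E
   <= prior_int lam pi (fun b => (expR (- sqnorm2 (Y - X *m b) / 2))%:E))%E.
Proof.
move=> lam0 p0 cX pi0; set S := supp bs.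
have y0 : 0 < p%:R :> R by rewrite ltr0n.
have sp : (#|S| <= p)%N by rewrite -[X in (_ <= X)%N]card_ord max_card.
apply: le_trans; last first.
  by apply: (@prior_int_ge_slab _ _ _ _ S) => //; first exact: ltW.
(* This side of the box meets both smallness conditions: [r #|S| lam <= 1] because [p >= 1], and
   [r #|S| |X| <= 1] because [|X| / p <= lam]. *)
have := @slab_lik_ge R n p X Y bs lam ((p%:R * #|S|%:R * lam)^-1) lam0.
rewrite -/S; set r := (_ * _ * lam)^-1 => h.
have r0 : 0 <= r by rewrite invr_ge0 !mulr_ge0// ltW.
(* An inequality rather than an equality, since for empty [S] the inverse defining [r] is [0]. *)
have rs : r * #|S|%:R <= (p%:R * lam)^-1.
  have [->|s0] := eqVneq (#|S|%:R : R) 0; first by rewrite mulr0 invr_ge0 mulr_ge0// ltW.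
  rewrite /r le_eqVlt; apply/orP; left; apply/eqP; move: (#|S|%:R : R) s0 => s s0; field.
  by rewrite s0 !gt_eqF.
have {}h := h r0.
have h1 : r * #|S|%:R * lam <= 1.
  apply: (le_trans (ler_wpM2r (ltW lam0) rs)).
  rewrite invfM -mulrA mulVf ?gt_eqF// mulr1 invf_le1//.
  by rewrite ler1n.
have h2 : r * #|S|%:R * colnorm X <= 1.
  apply: (le_trans (ler_wpM2r (colnorm_ge0 _) rs)).
  by rewrite mulrC ler_pdivrMr ?mulr_gt0// mul1r mulrC -ler_pdivrMr.
apply: le_trans (lee_wpmul2l _ (h h1 h2)); last first.
  by rewrite lee_fin divr_ge0// pi0.
rewrite -EFinM lee_fin.
have lr : lam * r / 2 = (p%:R * #|S|%:R)^-1 / 2.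
  rewrite /r; congr (_ / 2); have [->|s0] := eqVneq (#|S|%:R : R) 0.
    by rewrite mulr0 mul0r invr0 mulr0.
  by move: (#|S|%:R : R) s0 => s s0; field; rewrite s0 !gt_eqF.
rewrite lr; have := slab_weight_ge sp p0.
set A := _ ^+ #|S|; set B := _ ^+ #|S| => AB.
set E := (\sum_i _); set q := sqnorm2 _.
have -> : expR (- q / 2 - lam * E - 3 / 2) = expR (- 3 / 2) * expR (- (lam * E)) * expR (- q / 2).
  by rewrite -!expRD; congr expR; ring.
set E1 := expR (- 3 / 2); set E2 := expR (- (lam * E)); set E3 := expR (- q / 2).
have -> : pi #|S| * E1 * A * E2 * E3 = (pi #|S| * (E1 * E2 * E3)) * A by ring.
have -> : pi #|S| / 'C(p, #|S|)%:R * (E1 * E2 * E3 * B) =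
  (pi #|S| * (E1 * E2 * E3)) * (('C(p, #|S|)%:R)^-1 * B) by ring.
by rewrite ler_wpM2l// mulr_ge0// ?pi0// !mulr_ge0 ?expR_ge0.
Qed.

End Evidence.

(** * The numerator *)

Section Numerator.
Variable R : realType.
Local Notation mu := (@lebesgue_measure R).

Lemma plot_cst d (V : measurableType d) m (b : 'cV[R]_m) : plot (fun _ : V => b).
Proof. by move=> i; exact: measurable_cst. Qed.

Lemma plotD d (V : measurableType d) m (al be : V -> 'cV[R]_m) :
  plot al -> plot be -> plot (fun v => al v + be v).
Proof.
move=> pa pb i; apply: eq_measurable_fun (measurable_funD (pa i) (pb i)).
by move=> v _ /=; rewrite mxE.
Qed.

Lemma plot_mulmx d (V : measurableType d) n p (X : 'M[R]_(n, p)) (be : V -> 'cV[R]_p) :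
  plot be -> plot (fun v => X *m be v).
Proof.
move=> pb j; apply: (@eq_measurable_fun _ _ _ _ _ (fun v => \sum_i X j i * be v i 0)).
  by move=> v _; rewrite mxE.
by apply: measurable_sum => i; apply: measurable_funM => //; exact: measurable_cst.
Qed.

Lemma measurable_dot d (V : measurableType d) m (al be : V -> 'cV[R]_m) :
  plot al -> plot be -> measurable_fun setT (fun v => dot (al v) (be v)).
Proof. by move=> pa pb; apply: measurable_sum => i; exact: measurable_funM. Qed.

Lemma sqnorm2E m (v : 'cV[R]_m) : sqnorm2 v = dot v v.
Proof. by apply: eq_bigr => j _; rewrite expr2. Qed.

Lemma measurable_laplace d (V : measurableType d) (lam : R) (x : V -> R) :
  measurable_fun setT x -> measurable_fun setT (fun v => laplace_dens lam (x v)).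
Proof.
move=> mx; apply: measurable_funM; first exact: measurable_cst.
apply: (measurableT_comp (@measurable_expR R)).
apply: (measurableT_comp (@oppr_measurable R setT)).
apply: measurable_funM; first exact: measurable_cst.
exact: (measurableT_comp (@normr_measurable R setT)).
Qed.

Lemma measurable_gauss_dens : measurable_fun setT (@gauss_dens R).
Proof.
have -> : @gauss_dens R = normal_pdf 0 1 by apply/funext => x; exact: gauss_densE.
exact: measurable_normal_pdf.
Qed.

Lemma measurable_gauss_tilt (c u : R) :
  measurable_fun setT (fun x : R => gauss_dens (x + c) * expR (u * (x + c))).
Proof.
have ms : measurable_fun setT (fun x : R => x + c).
  by apply: measurable_funD => //; exact: measurable_cst.
apply: measurable_funM; first exact: (measurableT_comp measurable_gauss_dens).
apply: (measurableT_comp (@measurable_expR R)).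
by apply: measurable_funM => //; exact: measurable_cst.
Qed.

Variables (n p : nat) (X : 'M[R]_(n, p)) (lam a : R) (d : 'cV[R]_n) (bs : 'cV[R]_p).

(* Bound on the likelihood ratio of [b] to [bs] when all [|X_i . e| <= lambar]: the
   share [a (e . X (b - bs))] has been replaced by [lam / 2] times the l1 distance. *)
Definition tilt (e : 'cV[R]_n) (b : 'cV[R]_p) : R :=
  expR ((1 - a) * dot (e + d) (X *m (b - bs))
    + (lam / 2 * (\sum_i `|(b - bs) i 0|) + a * dot d (X *m (b - bs))
       - sqnorm2 (X *m (b - bs)) / 2)).

Definition slab_tilt (S : {set 'I_p}) (e : 'cV[R]_n) (b : 'cV[R]_p) : R :=
  tilt e b * \prod_(i in S) laplace_dens lam (b i 0).

Lemma slab_tilt_ge0 S e b : 0 <= lam -> 0 <= slab_tilt S e b.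
Proof.
move=> lam0; rewrite mulr_ge0 ?expR_ge0//.
by apply: prodr_ge0 => i _; exact: laplace_dens_ge0.
Qed.

Lemma measurable_slab_tilt dd (V : measurableType dd) (S : {set 'I_p})
    (al : V -> 'cV[R]_n) (be : V -> 'cV[R]_p) :
  plot al -> plot be -> measurable_fun setT (fun v => slab_tilt S (al v) (be v)).
Proof.
move=> pa pb; have pd : plot (fun v => be v - bs) by apply: plotD => //; exact: plot_cst.
have pX := plot_mulmx X pd.
have pad : plot (fun v => al v + d) by apply: plotD => //; exact: plot_cst.
have mc (c : R) : measurable_fun setT (fun _ : V => c) by exact: measurable_cst.
apply: measurable_funM; last first.
  under eq_fun do rewrite -big_enum.
  by apply: measurable_prod => i _; exact: measurable_laplace.
apply: (measurableT_comp (@measurable_expR R)).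
apply: measurable_funD; first by apply: measurable_funM => //; exact: measurable_dot.
apply: measurable_funB; last first.
  apply: measurable_funM => //; under eq_fun do rewrite sqnorm2E.
  exact: measurable_dot.
apply: measurable_funD; last first.
  by apply: measurable_funM => //; apply: measurable_dot => //; exact: plot_cst.
apply: measurable_funM => //; apply: measurable_sum => i.
exact: (measurableT_comp (@normr_measurable R setT) (pd i)).
Qed.

Lemma iterInt0 m (s : seq 'I_m) b : iterInt s (fun=> 0%E) b = 0%E :> \bar R.
Proof.
elim: s b => //= i s IH b; under eq_integral do rewrite IH; exact: integral0.
Qed.

(** Two reductions at fixed noise: slabs of dimension not above the threshold drop out, and on the
    others the likelihood is bounded by that of [bs] times [tilt]. *)
Lemma numerator_le (pi : nat -> R) (b0 : 'cV[R]_p) (lb : R) (B : set 'cV[R]_p)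
    (thr : \bar R) (e : 'cV[R]_n) :
  0 <= lam -> 0 <= a -> a * lb = lam / 2 -> d = X *m (b0 - bs) ->
  (forall s, (s <= p)%N -> 0 <= pi s) ->
  (forall b, B b -> thr < (#|supp b|%:R)%:E)%E ->
  (forall i, `|\sum_j X j i * e j 0| <= lb) ->
  (prior_int lam pi (fun b => (\1_B b)%:E *
      (expR (- sqnorm2 (X *m b0 + e - X *m b) / 2))%:E)
   <= (expR (- sqnorm2 (e + d) / 2))%:E *
      \sum_(S : {set 'I_p} | (thr < (#|S|%:R)%:E)%E) (pi #|S| / ('C(p, #|S|))%:R)%:E *
        iterInt (enum S) (fun b => (slab_tilt S e b)%:E) 0)%E.
Proof.
move=> lam0 a0 alb dE pi0 Bthr eT.
have w0 (S : {set 'I_p}) : 0 <= pi #|S| / ('C(p, #|S|))%:R.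
  by rewrite divr_ge0// pi0// -[X in (_ <= X)%N]card_ord max_card.
have st0 (S : {set 'I_p}) b : (0 <= (slab_tilt S e b)%:E)%E.
  by rewrite lee_fin slab_tilt_ge0.
rewrite ge0_sume_distrr; last first.
  move=> S _; apply: mule_ge0; first by rewrite lee_fin.
  exact: iterInt_ge0.
rewrite /prior_int [leRHS]big_mkcond/=; apply: lee_sum => S _.
have pl0 (b : 'cV[R]_p) : 0 <= \prod_(i in S) laplace_dens lam (b i 0).
  by apply: prodr_ge0 => i _; exact: laplace_dens_ge0.
have g0 (b : 'cV[R]_p) : (0 <= (\1_B b)%:E *
      (expR (- sqnorm2 (X *m b0 + e - X *m b) / 2))%:E *
      (\prod_(i in S) laplace_dens lam (b i 0))%:E)%E.
  by rewrite -!EFinM lee_fin !mulr_ge0 ?expR_ge0// indicE.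
case: ifPn => [_|nthr].
  rewrite muleCA; apply: lee_wpmul2l; first by rewrite lee_fin.
  rewrite -iterIntZl//; last first.
    move=> dd V be pb; apply/measurable_EFinP.
    by apply: measurable_slab_tilt => //; exact: plot_cst.
  apply: iterInt_le => // b; rewrite -!EFinM lee_fin /slab_tilt mulrA ler_wpM2r//.
  apply: (@le_trans _ _ (expR (- sqnorm2 (X *m b0 + e - X *m b) / 2))).
    by rewrite ler_piMl ?expR_ge0// indicE; case: (_ \in _).
  rewrite -expRD ler_expR; set t := X *m (b - bs).
  have -> : X *m b0 + e - X *m b = (e + d) - t.
    rewrite /t dE !mulmxBr; move: (X *m b0) (X *m b) (X *m bs) => u v w.
    by apply/matrixP => j k; rewrite !mxE; ring.
  (* The share [a] of the noise term is bounded by [a lb = lam / 2] times the l1 distance; the share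
     [1 - a] is left to be integrated. *)
  rewrite sqnorm2B; have et : dot e t <= lb * \sum_i `|(b - bs) i 0|.
    rewrite dot_mulmx mulr_sumr; apply: ler_sum => i _.
    apply: (le_trans (ler_norm _)); rewrite normrM ler_wpM2r//.
  have := ler_wpM2l a0 et; rewrite mulrA alb.
  have -> : dot (e + d) t = (1 - a) * dot (e + d) t + a * (dot e t + dot d t).
    by rewrite dotDl; ring.
  by rewrite !dotDl; lra.
(* A vector of the slab [S] has its support inside [S], so it cannot lie in [B] when [#|S|] is not
   above the threshold. *)
apply: (@le_trans _ _ ((pi #|S| / ('C(p, #|S|))%:R)%:E * 0)%E); last by rewrite mule0.
apply: lee_wpmul2l; first by rewrite lee_fin.
rewrite -[leRHS](@iterInt0 p (enum S) 0).
apply: (proj2 (andP (_ : (0 <= _)%E && _))).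
apply: iterInt_le_off => b boff; rewrite g0/=.
suff nB : ~ B b by rewrite indicE memNset// !mul0e.
move=> /Bthr bthr; move/negP: nthr; apply; apply: (lt_le_trans bthr).
rewrite lee_fin ler_nat subset_leq_card//; apply/fintype.subsetP => i; rewrite inE.
by apply: contraNT => iS; rewrite boff ?mem_enum// mxE.
Qed.

(** After the noise is integrated, [hexp] leaves the Laplace kernel of rate [lam / 4] centred at
    [bs] in each coordinate of [S]. With the prior factor [lam / 2] each such integral equals
    [lam / 2 * (8 / lam) = 4]. *)
Lemma iterInt_slab_tilt_le (S : {set 'I_p}) (r : R) :
  0 < lam ->
  (forall b : 'cV[R]_p, lam * (\sum_i `|bs i 0|) - lam * (\sum_i `|b i 0|)
    + lam / 2 * (\sum_i `|(b - bs) i 0|)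
    + a * dot d (X *m (b - bs)) - sqnorm2 (X *m (b - bs)) / 2
    + (1 - a) ^+ 2 * sqnorm2 (X *m (b - bs)) / 2
    <= - (lam / 4 * (\sum_i `|(b - bs) i 0|)) + r) ->
  (intRm (fun e => iterInt (enum S) (fun b => (slab_tilt S e b)%:E) 0
      * (\prod_(j < n) gauss_dens ((e + d) j 0))%:E)
  <= (expR (r - lam * (\sum_i `|bs i 0|)) * 4 ^+ #|S|)%:E)%E.
Proof.
move=> lam0 hexp.
have ph0 (e : 'cV[R]_n) : 0 <= \prod_(j < n) gauss_dens ((e + d) j 0).
  by apply: prodr_ge0 => j _; exact: gauss_dens_ge0.
have st0 (T : {set 'I_p}) e b : 0 <= slab_tilt T e b by exact/slab_tilt_ge0/ltW.
pose H (e : 'cV[R]_n) (b : 'cV[R]_p) :=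
  (slab_tilt S e b * \prod_(j < n) gauss_dens ((e + d) j 0))%:E.
have -> : intRm (fun e => iterInt (enum S) (fun b => (slab_tilt S e b)%:E) 0
      * (\prod_(j < n) gauss_dens ((e + d) j 0))%:E)%E =
    intRm (fun e => iterInt (enum S) (H e) 0).
  rewrite /intRm; congr iterInt; apply/funext => e; rewrite muleC -iterIntZl//.
  - by congr iterInt; apply/funext => b; rewrite /H mulrC EFinM.
  - by move=> b; rewrite lee_fin.
  - move=> dd V be pb; apply/measurable_EFinP.
    by apply: measurable_slab_tilt => //; exact: plot_cst.
  - by rewrite lee_fin.
rewrite /intRm (iterInt_swap (enum 'I_n) (enum S) (H := H) 0 0); last 2 first.
- by move=> e b; rewrite lee_fin mulr_ge0.
- move=> dd V al be pa pb; apply/measurable_EFinP; apply: measurable_funM.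
    exact: measurable_slab_tilt.
  apply: measurable_prod => j _; apply: (measurableT_comp measurable_gauss_dens).
  exact: (plotD pa (plot_cst d) j).
pose G (b : 'cV[R]_p) : R := expR (lam / 2 * (\sum_i `|(b - bs) i 0|) + a * dot d (X *m (b - bs))
       - sqnorm2 (X *m (b - bs)) / 2) * \prod_(i in S) laplace_dens lam (b i 0).
have G0 b : 0 <= G b.
  rewrite mulr_ge0 ?expR_ge0//; apply: prodr_ge0 => i _.
  exact/laplace_dens_ge0/ltW.
(* Under the density used here [e + d] is standard Gaussian, so this is its moment generating
   function at [(1 - a) t]. *)
have inner b : iterInt (enum 'I_n) (H^~ b) 0 =
    (G b * expR ((1 - a) ^+ 2 * sqnorm2 (X *m (b - bs)) / 2))%:E.
  set t := X *m (b - bs).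
  pose f j x := gauss_dens (x + d j 0) * expR ((1 - a) * t j 0 * (x + d j 0)).
  have -> : expR ((1 - a) ^+ 2 * sqnorm2 t / 2) =
      \prod_(j <- enum 'I_n) expR (((1 - a) * t j 0) ^+ 2 / 2).
    rewrite big_enum -expR_sum /sqnorm2 mulr_sumr mulr_suml; congr expR.
    by apply: eq_bigr => j _; rewrite exprMn.
  rewrite -(@iterInt_prod _ _ (enum 'I_n) f _ (G b) 0) ?enum_uniq//.
  - congr iterInt; apply/funext => e; congr EFin; rewrite /H /slab_tilt /tilt expRD.
    have fe j : f j (e j 0) = gauss_dens ((e + d) j 0) * expR ((1 - a) * ((e + d) j 0 * t j 0)).
      have -> : (e + d) j 0 = e j 0 + d j 0 by rewrite mxE.
      by rewrite /f; congr (_ * expR _); ring.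
    have -> : \prod_(j <- enum 'I_n) f j (e j 0) =
        (\prod_(j < n) gauss_dens ((e + d) j 0)) * expR ((1 - a) * dot (e + d) t).
      rewrite big_enum /dot mulr_sumr expR_sum -big_split/=.
      by apply: eq_big => // j _; exact: fe.
    by rewrite /G -/t; ring.
  - by move=> j x; rewrite mulr_ge0 ?expR_ge0 ?gauss_dens_ge0.
  - by move=> j; exact: measurable_gauss_tilt.
  - by move=> j; exact: integral_gauss_tilt.
under eq_fun do rewrite inner.
pose g i x := lam / 2 * expR (- (lam / 4 * `|x - bs i 0|)).
have c0 : 0 <= expR (r - lam * (\sum_i `|bs i 0|)) by exact: expR_ge0.
have lam2 : 0 < lam / 2 by rewrite divr_gt0.
have lam4 : 0 < lam / 4 by rewrite divr_gt0.
have mlap (i : 'I_p) : measurable_fun setT (fun x : R => expR (- (lam / 4 * `|x - bs i 0|))).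
  apply: (measurableT_comp (@measurable_expR R)).
  apply: (measurableT_comp (@oppr_measurable R setT)).
  apply: measurable_funM; first exact: measurable_cst.
  apply: (measurableT_comp (@normr_measurable R setT)).
  by apply: measurable_funB => //; exact: measurable_cst.
have -> : 4 ^+ #|S| = \prod_(i <- enum S) 4 :> R.
  by rewrite big_const_seq count_predT -cardE iter_mulr_1.
rewrite -(@iterInt_prod _ _ (enum S) g _ _ 0) ?enum_uniq//; last 3 first.
- by move=> i x; rewrite mulr_ge0 ?expR_ge0 ?ltW.
- by move=> i; apply: measurable_funM => //; exact: measurable_cst.
- move=> i; rewrite /g; under eq_integral do rewrite EFinM.
  rewrite ge0_integralZl//; last 2 first.
  + by apply: measurable_EFin_comp; exact: mlap.
  + by rewrite lee_fin ltW.
  by rewrite integral_laplace// -EFinM; congr EFin; field; rewrite gt_eqF.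
apply: (proj2 (andP (_ : (0 <= _)%E && _))).
apply: iterInt_le_off => b boff; rewrite !lee_fin mulr_ge0 ?expR_ge0//=.
have bS : \sum_i `|b i 0| = \sum_(i in S) `|b i 0|.
  rewrite (bigID (mem S))/= [X in _ + X]big1 ?addr0// => i iS.
  by rewrite boff ?mem_enum// mxE normr0.
pose Pc : R := \prod_(i in S) (lam / 2).
have lapE : \prod_(i in S) laplace_dens lam (b i 0) = Pc * expR (- (lam * \sum_i `|b i 0|)).
  by rewrite big_split/= -expR_sum sumrN -mulr_sumr -bS.
have gE : \prod_(i in S) g i (b i 0) = Pc * expR (- (lam / 4 * \sum_(i in S) `|b i 0 - bs i 0|)).
  by rewrite big_split/= -expR_sum sumrN -mulr_sumr.
rewrite big_enum/= gE /G lapE.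
have Pc0 : 0 <= Pc by apply: prodr_ge0 => i _; exact: ltW.
rewrite [leRHS]mulrCA (mulrCA _ Pc) -[leLHS]mulrA -!expRD ler_wpM2l// ler_expR.
have hd : \sum_(i in S) `|b i 0 - bs i 0| <= \sum_i `|(b - bs) i 0|.
  rewrite (sum_l1on S) /l1on.
  under [X in X + _]eq_bigr do rewrite !mxE.
  by rewrite lerDl sumr_ge0.
have h4 := ler_wpM2l (ltW lam4) hd.
have := hexp b.
move: (\sum_i `|b i 0|) (\sum_i `|bs i 0|) (\sum_i `|(b - bs) i 0|)
  (\sum_(i in S) `|b i 0 - bs i 0|) h4 => s1 s2 s3 s4; lra.
Qed.

End Numerator.

(** * Expectation of the posterior mass *)

Section Expectation.
Variable R : realType.

Lemma prior_int_ge0 p (lam : R) (pi : nat -> R) (f : 'cV[R]_p -> \bar R) :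
  0 <= lam -> (forall s, (s <= p)%N -> 0 <= pi s) -> (forall b, 0 <= f b)%E ->
  (0 <= prior_int lam pi f)%E.
Proof.
move=> lam0 pi0 f0; apply: sume_ge0 => U _; apply: mule_ge0.
  by rewrite lee_fin divr_ge0// pi0// -[X in (_ <= X)%N]card_ord max_card.
apply: iterInt_ge0 => b; apply: mule_ge0 => //; rewrite lee_fin.
by apply: prodr_ge0 => i _; exact: laplace_dens_ge0.
Qed.

Lemma prior_int_le p (lam : R) (pi : nat -> R) (f g : 'cV[R]_p -> \bar R) :
  0 <= lam -> (forall s, (s <= p)%N -> 0 <= pi s) -> (forall b, 0 <= f b)%E ->
  (forall b, f b <= g b)%E ->
  (prior_int lam pi f <= prior_int lam pi g)%E.
Proof.
move=> lam0 pi0 f0 fg; apply: lee_sum => U _; apply: lee_wpmul2l.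
  by rewrite lee_fin divr_ge0// pi0// -[X in (_ <= X)%N]card_ord max_card.
have pl0 (b : 'cV[R]_p) : 0 <= \prod_(i in U) laplace_dens lam (b i 0).
  by apply: prodr_ge0 => i _; exact: laplace_dens_ge0.
apply: iterInt_le => b; first by rewrite mule_ge0// lee_fin.
by apply: lee_wpmul2r; rewrite ?lee_fin.
Qed.

(** The parallelogram identity in the exponent. Divided by [gauss_dens (x + y)] and integrated, it
    says that the second moment of the density ratio is [expR (y ^+ 2)]. *)
Lemma gauss_dens_sqr (x y : R) :
  gauss_dens x ^+ 2 = gauss_dens (x + y) * gauss_dens (x - y) * expR (y ^+ 2).
Proof.
rewrite /gauss_dens; set c := (Num.sqrt _)^-1.
have -> : (c * expR (- x ^+ 2 / 2)) ^+ 2 =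
  c ^+ 2 * (expR (- x ^+ 2 / 2) * expR (- x ^+ 2 / 2)) by ring.
have -> : forall u v w : R, c * u * (c * v) * w = c ^+ 2 * (u * v * w) by move=> *; ring.
by rewrite -!expRD; congr (_ * expR _); field.
Qed.

Lemma prod_gauss_dens_sqr m (e d : 'cV[R]_m) :
  (\prod_(j < m) gauss_dens (e j 0)) ^+ 2 =
  (\prod_(j < m) gauss_dens ((e + d) j 0)) *
  (\prod_(j < m) gauss_dens (e j 0 - d j 0)) * expR (sqnorm2 d).
Proof.
rewrite -prodrXl /sqnorm2 expR_sum -!big_split/=; apply: eq_bigr => j _.
by rewrite mxE -gauss_dens_sqr.
Qed.

Lemma prod_gauss_dens_gt0 m (e : 'cV[R]_m) : 0 < \prod_(j < m) gauss_dens (e j 0).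
Proof. by apply: prodr_gt0 => j _; exact: gauss_dens_gt0. Qed.

Lemma intRm_gauss_tilt m (c : R) (d u : 'cV[R]_m) : 0 <= c ->
  intRm (fun e => (c * \prod_(j <- enum 'I_m)
      (gauss_dens (e j 0 + d j 0) * expR (u j 0 * (e j 0 + d j 0))))%:E) =
  (c * expR (sqnorm2 u / 2))%:E.
Proof.
move=> c0; pose f j x := gauss_dens (x + d j 0) * expR (u j 0 * (x + d j 0)).
rewrite /intRm (@iterInt_prod _ _ (enum 'I_m) f (fun j => expR (u j 0 ^+ 2 / 2)) c 0) ?enum_uniq//.
- by rewrite big_enum/= -expR_sum -mulr_suml.
- by move=> j x; rewrite mulr_ge0 ?expR_ge0 ?gauss_dens_ge0.
- by move=> j; exact: measurable_gauss_tilt.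
- by move=> j; exact: integral_gauss_tilt.
Qed.

Lemma cmeas_gauss_tilt m (c : R) (d u : 'cV[R]_m) :
  cmeas (fun e => (c * \prod_(j <- enum 'I_m)
      (gauss_dens (e j 0 + d j 0) * expR (u j 0 * (e j 0 + d j 0))))%:E).
Proof.
move=> dd V be pb; apply/measurable_EFinP.
apply: measurable_funM; first exact: measurable_cst.
apply: measurable_prod => j _.
exact: (measurableT_comp (measurable_gauss_tilt (d j 0) (u j 0)) (pb j)).
Qed.

(* Chernoff terms: the boolean selects the sign of [X_i . e]. *)
Definition tail_dir n p (X : 'M[R]_(n, p)) (u : R) (k : 'I_p * bool) : 'cV[R]_n :=
  \col_j ((-1) ^+ k.2 * u * X j k.1).

(** The shift by [0] is kept so that the term has the shape of [intRm_gauss_tilt]; [tail_termE]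
    gives the usual form. *)
Definition tail_term n p (X : 'M[R]_(n, p)) (u lb : R) (k : 'I_p * bool) (e : 'cV[R]_n) : R :=
  expR (- (u * lb)) * \prod_(j <- enum 'I_n)
    (gauss_dens (e j 0 + (0 : 'cV[R]_n) j 0) *
     expR (tail_dir X u k j 0 * (e j 0 + (0 : 'cV[R]_n) j 0))).

Lemma tail_term_ge0 n p (X : 'M[R]_(n, p)) (u lb : R) k e : 0 <= tail_term X u lb k e.
Proof.
rewrite mulr_ge0 ?expR_ge0//; apply: prodr_ge0 => j _.
by rewrite mulr_ge0 ?expR_ge0 ?gauss_dens_ge0.
Qed.

Lemma tail_termE n p (X : 'M[R]_(n, p)) (u lb : R) k e :
  tail_term X u lb k e = (\prod_(j < n) gauss_dens (e j 0)) *
    expR (u * ((-1) ^+ k.2 * (\sum_j X j k.1 * e j 0) - lb)).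
Proof.
have -> : u * ((-1) ^+ k.2 * (\sum_j X j k.1 * e j 0) - lb) =
   - (u * lb) + \sum_j (tail_dir X u k j 0 * e j 0).
  rewrite mulrBr addrC mulr_sumr mulr_sumr; congr (_ + _).
  by apply: eq_bigr => j _; rewrite mxE; ring.
rewrite expRD mulrCA /tail_term; congr (_ * _).
rewrite big_enum/= expR_sum -big_split/=; apply: eq_big => // j _.
by rewrite [(0 : 'cV_n) j 0]mxE addr0.
Qed.

(** Pointwise union bound: for the index [i] and the sign of its score the Chernoff exponent is
    nonnegative, and the other terms are nonnegative. *)
Lemma tail_le n p (X : 'M[R]_(n, p)) (u lb : R) (e : 'cV[R]_n) (i : 'I_p) : 0 <= u ->
  lb < `|\sum_j X j i * e j 0| ->
  \prod_(j < n) gauss_dens (e j 0) <= \sum_(k : 'I_p * bool) tail_term X u lb k e.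
Proof.
move=> u0 ei; set c := \sum_j X j i * e j 0 in ei.
have g0 := prod_gauss_dens_gt0 e.
suff [b hb] : exists b : bool, lb <= (-1) ^+ b * c.
  rewrite (bigD1 (i, b))//= ler_wpDr//; first by apply: sumr_ge0 => *; exact: tail_term_ge0.
  rewrite tail_termE/= ler_peMr ?(ltW g0)// -[leLHS]expR0 ler_expR.
  by rewrite mulr_ge0// subr_ge0.
by exists (c < 0); rewrite -normrEsign ltW.
Qed.

(** The value [u = lb / |X|^2] minimises the Chernoff exponent [- u lb + u^2 |X|^2 / 2]. *)
Lemma intRm_tail_term_le n p (X : 'M[R]_(n, p)) (lb : R) k : 0 < colnorm X ->
  (intRm (fun e => (tail_term X (lb / colnorm X ^+ 2) lb k e)%:E)
    <= (expR (- (lb ^+ 2 / (2 * colnorm X ^+ 2))))%:E)%E.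
Proof.
move=> c0; rewrite intRm_gauss_tilt ?expR_ge0// lee_fin -expRD ler_expR.
have -> : sqnorm2 (tail_dir X (lb / colnorm X ^+ 2) k) =
    (lb / colnorm X ^+ 2) ^+ 2 * \sum_j X j k.1 ^+ 2.
  rewrite mulr_sumr; apply: eq_bigr => j _; rewrite mxE !exprMn.
  by rewrite -exprM mulnC exprM sqrrN expr1n expr1n mul1r.
have := ler_wpM2l (sqr_ge0 (lb / colnorm X ^+ 2)) (col_le_colnorm X k.1).
have -> : (lb / colnorm X ^+ 2) ^+ 2 * colnorm X ^+ 2 = lb ^+ 2 / colnorm X ^+ 2.
  by field; rewrite gt_eqF.
have -> : lb / colnorm X ^+ 2 * lb = lb ^+ 2 / colnorm X ^+ 2 by ring.
have -> : lb ^+ 2 / (2 * colnorm X ^+ 2) = lb ^+ 2 / colnorm X ^+ 2 / 2.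
  by field; rewrite gt_eqF.
by move=> h; lra.
Qed.

End Expectation.

(** * Three-way split of the expected posterior mass *)

Section PosteriorBound.
Variable R : realType.

Lemma posterior_le1 n p (X : 'M[R]_(n, p)) (lam : R) (pi : nat -> R) (B : set 'cV[R]_p)
    (Y : 'cV[R]_n) (L : R) : 0 <= lam -> (forall s, (s <= p)%N -> 0 <= pi s) ->
  0 < L ->
  (L%:E <= prior_int lam pi (fun b => (expR (- sqnorm2 (Y - X *m b) / 2))%:E))%E ->
  (0 <= posterior X lam pi B Y <= 1)%E /\
  (posterior X lam pi B Y <= (L^-1)%:E *
    prior_int lam pi (fun b => (\1_B b)%:E * (expR (- sqnorm2 (Y - X *m b) / 2))%:E))%E.
Proof.
move=> lam0 pi0 L0; rewrite /posterior; set D := prior_int _ _ (fun b => (expR _)%:E).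
set N := prior_int _ _ _ => LD.
have N0 : (0 <= N)%E.
  by apply: prior_int_ge0 => // b; rewrite -EFinM lee_fin mulr_ge0 ?expR_ge0// indicE.
have ND : (N <= D)%E.
  apply: prior_int_le => // b; rewrite -?EFinM lee_fin ?mulr_ge0 ?expR_ge0 ?indicE//.
  by rewrite ler_piMl ?expR_ge0//; case: (_ \in _).
case: D LD ND => [D|_ _|//].
- rewrite !lee_fin => LD ND; have D0 : 0 < D by exact: lt_le_trans LD.
  rewrite inver gt_eqF//; case: N N0 ND => [N| |]//; rewrite !lee_fin => N0 ND.
  rewrite divr_ge0 ?(ltW D0)//= ler_pdivrMr// mul1r; split => //.
  by rewrite mulrC ler_wpM2r// lef_pV2.
(* If the normalising constant is infinite, its inverse is [0] and the posterior vanishes. *)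
- rewrite invey mule0 lexx lee01; split => //.
  by rewrite mule_ge0// lee_fin invr_ge0 ltW.
Qed.

Lemma sum_tail_terms n p (X : 'M[R]_(n, p)) (lb q : R) : 0 < colnorm X ->
  (forall k, intRm (fun e => (tail_term X (lb / colnorm X ^+ 2) lb k e)%:E) <= q%:E)%E ->
  (intRm (fun e => (\sum_(k : 'I_p * bool) tail_term X (lb / colnorm X ^+ 2) lb k e)%:E)
   <= (p%:R * 2 * q)%:E)%E.
Proof.
move=> c0 hq; rewrite /intRm.
have -> : (fun e => (\sum_(k : 'I_p * bool) tail_term X (lb / colnorm X ^+ 2) lb k e)%:E) =
    (fun e => \sum_(k : 'I_p * bool) (tail_term X (lb / colnorm X ^+ 2) lb k e)%:E)%E.
  by apply/funext => e; rewrite sumEFin.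
rewrite iterInt_sum; last 2 first.
- by move=> k b; rewrite lee_fin tail_term_ge0.
- by move=> k; exact: cmeas_gauss_tilt.
apply: (@le_trans _ _ (\sum_(k : 'I_p * bool) q%:E)%E).
  by apply: lee_sum => k _; exact: hq.
rewrite sumEFin lee_fin sumr_const card_prod card_ord card_bool.
by rewrite -[leLHS]mulr_natl natrM.
Qed.

Lemma cmeas_sum m (I : Type) (r : seq I) (P : pred I) (f : I -> 'cV[R]_m -> \bar R) :
  (forall k, cmeas (f k)) -> cmeas (fun b => \sum_(k <- r | P k) f k b)%E.
Proof.
move=> mf dd V be pb.
have -> : (fun v => \sum_(k <- r | P k) f k (be v))%E =
    (fun v => \sum_(k <- r) (if P k then f k (be v) else 0))%E.
  by apply/funext => v; rewrite [LHS]big_mkcond.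
apply: emeasurable_sum => k; case: (P k); first exact: mf.
exact: measurable_cst.
Qed.

(** Posterior times noise density is majorised pointwise by [F1 + F2 + F3]: [F1] where some score
    exceeds [lb], [F2] where the density at mean [X b0] exceeds [kap] times that at mean [X bs], and
    [F3] elsewhere. Their integrals give the three terms of the bound. *)
Lemma expect_posterior_le n p (X : 'M[R]_(n, p)) (lam a lb r kap L0 : R)
    (pi : nat -> R) (b0 bs : 'cV[R]_p) (B : set 'cV[R]_p) (thr : \bar R) :
  0 < lam -> 0 < colnorm X -> 0 <= lb -> 0 <= a -> a * lb = lam / 2 ->
  (forall s, (s <= p)%N -> 0 <= pi s) ->
  (forall b, B b -> thr < (#|supp b|%:R)%:E)%E ->
  0 < L0 ->
  (forall Y, ((L0 * expR (- sqnorm2 (Y - X *m bs) / 2))%:E <=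
     prior_int lam pi (fun b => (expR (- sqnorm2 (Y - X *m b) / 2))%:E))%E) ->
  0 < kap ->
  (forall b : 'cV[R]_p, lam * (\sum_i `|bs i 0|) - lam * (\sum_i `|b i 0|)
    + lam / 2 * (\sum_i `|(b - bs) i 0|)
    + a * dot (X *m (b0 - bs)) (X *m (b - bs)) - sqnorm2 (X *m (b - bs)) / 2
    + (1 - a) ^+ 2 * sqnorm2 (X *m (b - bs)) / 2
    <= - (lam / 4 * (\sum_i `|(b - bs) i 0|)) + r) ->
  (expect X b0 (posterior X lam pi B) <=
   (p%:R * 2 * expR (- (lb ^+ 2 / (2 * colnorm X ^+ 2)))
    + kap^-1 * expR (sqnorm2 (X *m (b0 - bs)))
    + kap / L0 * \sum_(S : {set 'I_p} | (thr < (#|S|%:R)%:E)%E)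
        pi #|S| / ('C(p, #|S|))%:R * (expR (r - lam * (\sum_i `|bs i 0|)) * 4 ^+ #|S|))%:E)%E.
Proof.
move=> lam0 c0 lb0 a0 alb pi0 Bthr L00 evid kap0 hexp.
set d := X *m (b0 - bs); pose u := lb / colnorm X ^+ 2.
have u0 : 0 <= u by rewrite divr_ge0// sqr_ge0.
pose F1 (e : 'cV[R]_n) := (\sum_(k : 'I_p * bool) tail_term X u lb k e)%:E.
(* A tilt in direction [0], so that [intRm_gauss_tilt] and its measurability apply. *)
pose F2 (e : 'cV[R]_n) := (kap^-1 * expR (sqnorm2 d) * \prod_(j <- enum 'I_n)
      (gauss_dens (e j 0 + (- d) j 0) * expR ((0 : 'cV[R]_n) j 0 * (e j 0 + (- d) j 0))))%:E.
pose I (S : {set 'I_p}) (e : 'cV[R]_n) :=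
  iterInt (enum S) (fun b => (slab_tilt X lam a d bs S e b)%:E) 0.
pose K S (e : 'cV[R]_n) := (I S e * (\prod_(j < n) gauss_dens ((e + d) j 0))%:E)%E.
pose w (S : {set 'I_p}) : R := pi #|S| / ('C(p, #|S|))%:R.
pose F3 (e : 'cV[R]_n) :=
  ((kap / L0)%:E * \sum_(S : {set 'I_p} | (thr < (#|S|%:R)%:E)%E) (w S)%:E * K S e)%E.
have w0 (S : {set 'I_p}) : 0 <= w S.
  by rewrite divr_ge0// pi0// -[X in (_ <= X)%N]card_ord max_card.
have I0 S e : (0 <= I S e)%E.
  by apply: iterInt_ge0 => b; rewrite lee_fin slab_tilt_ge0// ltW.
have pg0 (e : 'cV[R]_n) : 0 < \prod_(j < n) gauss_dens (e j 0) := prod_gauss_dens_gt0 e.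
have K0 S e : (0 <= K S e)%E by rewrite mule_ge0// lee_fin ltW.
have kL0 : 0 <= kap / L0 by rewrite divr_ge0 ?ltW.
have F10 e : (0 <= F1 e)%E by rewrite lee_fin sumr_ge0// => *; exact: tail_term_ge0.
have F2E e : F2 e = (kap^-1 * expR (sqnorm2 d) * \prod_(j < n) gauss_dens (e j 0 - d j 0))%:E.
  rewrite /F2 big_enum/=; congr (_ * _)%:E; apply: eq_big => // j _.
  by rewrite !mxE mul0r expR0 mulr1.
have F20 e : (0 <= F2 e)%E.
  rewrite F2E lee_fin mulr_ge0//; first by rewrite mulr_ge0 ?expR_ge0// invr_ge0 ltW.
  by apply: prodr_ge0 => j _; exact: gauss_dens_ge0.
have F30 e : (0 <= F3 e)%E.
  by rewrite mule_ge0// sume_ge0// => S _; rewrite mule_ge0// lee_fin.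
have mF1 : cmeas F1.
  have -> : F1 = (fun e => \sum_(k : 'I_p * bool) (tail_term X u lb k e)%:E)%E.
    by apply/funext => e; rewrite sumEFin.
  by apply: cmeas_sum => k; exact: cmeas_gauss_tilt.
have mF2 : cmeas F2 by exact: cmeas_gauss_tilt.
have mK S : cmeas (K S).
  move=> dd V be pb; apply: emeasurable_funM; last first.
    apply/measurable_EFinP; apply: measurable_prod => j _.
    apply: (measurableT_comp (@measurable_gauss_dens R)).
    exact: (plotD pb (plot_cst d) j).
  apply: (@iterInt_jmeas _ _ V _ (enum S) (fun v b => (slab_tilt X lam a d bs S (be v) b)%:E)
     _ _ _ V id (fun=> 0)) => //.
  - by move=> v b; rewrite lee_fin slab_tilt_ge0// ltW.
  - move=> d' W tw ga mtw pga; apply/measurable_EFinP; apply: measurable_slab_tilt => //.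
    by move=> j; exact: (measurableT_comp (pb j)).
have mwK S : cmeas (fun e => (w S)%:E * K S e)%E.
  move=> dd V be pb; apply: emeasurable_funM; first exact: measurable_cst.
  exact: mK.
have mS : cmeas (fun e => \sum_(S : {set 'I_p} | (thr < (#|S|%:R)%:E)%E) (w S)%:E * K S e)%E.
  exact: cmeas_sum.
have mF3 : cmeas F3.
  by move=> dd V be pb; apply: emeasurable_funM; [exact: measurable_cst|exact: mS].
have step e : (0 <= posterior X lam pi B (X *m b0 + e) * (\prod_(j < n) gauss_dens (e j 0))%:E)%E
  /\ (posterior X lam pi B (X *m b0 + e) * (\prod_(j < n) gauss_dens (e j 0))%:E
      <= F1 e + (F2 e + F3 e))%E.
  set Y := X *m b0 + e; set q := \prod_(j < n) gauss_dens (e j 0).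
  set q' := \prod_(j < n) gauss_dens ((e + d) j 0).
  have q0 : 0 < q by exact: pg0.
  have q'0 : 0 < q' by exact: pg0.
  have Ye : Y - X *m bs = e + d by rewrite /Y /d mulmxBr addrAC addrC.
  have L0' : 0 < L0 * expR (- sqnorm2 (e + d) / 2) by rewrite mulr_gt0 ?expR_gt0.
  have eY := evid Y; rewrite Ye in eY.
  have [/andP[P0 P1] PN] := posterior_le1 B (ltW lam0) pi0 L0' eY.
  split; first by rewrite mule_ge0// lee_fin ltW.
  have Pq : (posterior X lam pi B Y * q%:E <= q%:E)%E.
    by rewrite -[leRHS]mul1e; apply: lee_wpmul2r => //; rewrite lee_fin ltW.
  have [/forallP eT|/forallPn[i]] := boolP [forall i, `|\sum_j X j i * e j 0| <= lb]; last first.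
    rewrite -ltNge => ei; apply: (le_trans Pq).
    apply: (@le_trans _ _ (F1 e)); last by rewrite leeDl// adde_ge0.
    by rewrite lee_fin; exact: tail_le ei.
  (* Where the density at mean [X b0] is at most [kap] times that at mean [X bs], it is
     replaced by the latter; elsewhere the posterior is bounded by [1]. *)
  have [qk|qk] := lerP q (kap * q').
    apply: (@le_trans _ _ (F3 e)); last by rewrite addeA leeDr// adde_ge0.
    have NU := numerator_le (ltW lam0) a0 alb (erefl d) pi0 Bthr eT.
    set Sg := (\sum_(S | _) _)%E in NU.
    have Sg0 : (0 <= Sg)%E.
      by rewrite sume_ge0// => S _; apply: mule_ge0; [rewrite lee_fin; exact: w0|exact: I0].
    have Li0 : 0 <= (L0 * expR (- sqnorm2 (e + d) / 2))^-1 by rewrite invr_ge0 ltW.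
    (* The likelihood at [bs], which is [expR (- sqnorm2 (e + d) / 2)], cancels between the
       numerator and the lower bound on the evidence. *)
    have PS : (posterior X lam pi B Y <= (L0^-1)%:E * Sg)%E.
      apply: (le_trans PN); apply: (@le_trans _ _ ((L0 * expR (- sqnorm2 (e + d) / 2))^-1%:E *
         ((expR (- sqnorm2 (e + d) / 2))%:E * Sg))%E).
        by apply: lee_wpmul2l; rewrite ?lee_fin.
      rewrite muleA -EFinM invfM -mulrA mulVf ?gt_eqF ?expR_gt0// mulr1.
      exact: lexx.
    apply: (@le_trans _ _ ((L0^-1)%:E * Sg * (kap * q')%:E)%E).
      apply: (@le_trans _ _ ((L0^-1)%:E * Sg * q%:E)%E).
        by apply: lee_wpmul2r => //; rewrite lee_fin ltW.
      by apply: lee_wpmul2l; rewrite ?lee_fin// mule_ge0// lee_fin invr_ge0 ltW.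
    rewrite EFinM muleACA -EFinM [L0^-1 * kap]mulrC /F3.
    apply: lee_wpmul2l; first by rewrite lee_fin.
    rewrite ge0_sume_distrl; last first.
      by move=> S _; apply: mule_ge0; [rewrite lee_fin; exact: w0|exact: I0].
    by apply: lee_sum => S _; rewrite /K muleA.
  apply: (le_trans Pq); apply: (@le_trans _ _ (F2 e)); last by rewrite addeCA leeDl// adde_ge0.
  (* Here [q' < q / kap], so [q ^ 2 = q' q2 exp |d|^2] yields [q <= kap^-1 exp |d|^2 q2], where [q2]
     is the Gaussian density centred at [d]. *)
  rewrite F2E lee_fin -(ler_pM2l q0) -expr2 (prod_gauss_dens_sqr e d) -/q'.
  set q2 := \prod_(j < n) gauss_dens (e j 0 - d j 0).
  have q20 : 0 <= q2 by apply: prodr_ge0 => j _; exact: gauss_dens_ge0.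
  have -> : q * (kap^-1 * expR (sqnorm2 d) * q2) = (q / kap) * (q2 * expR (sqnorm2 d)) by ring.
  rewrite -mulrA ler_wpM2r ?mulr_ge0 ?expR_ge0//.
  by rewrite ler_pdivlMr// mulrC ltW.
(* From here on only the majorant is integrated; its three terms are measurable, so additivity
   applies. *)
apply: (@le_trans _ _ (intRm (fun e => F1 e + (F2 e + F3 e))%E)).
  by apply: iterInt_le => e; have [] := step e.
rewrite /intRm iterIntD//; last 2 first.
- by move=> e; rewrite adde_ge0.
- by move=> dd V be pb; apply: emeasurable_funD; [exact: mF2|exact: mF3].
rewrite iterIntD// addeA !EFinD; apply: leeD; first apply: leeD.
- by apply: sum_tail_terms => // k; exact: intRm_tail_term_le.
- have := @intRm_gauss_tilt R n (kap^-1 * expR (sqnorm2 d)) (- d) 0.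
  rewrite /intRm => ->; last by rewrite mulr_ge0 ?expR_ge0// invr_ge0 ltW.
  have -> : sqnorm2 (0 : 'cV[R]_n) = 0.
    by apply: big1 => j _; rewrite mxE expr0n.
  by rewrite mul0r expR0 mulr1.
- rewrite iterIntZl//; last by move=> e; rewrite sume_ge0// => S _; rewrite mule_ge0// lee_fin.
  rewrite [leRHS]EFinM; apply: lee_wpmul2l; first by rewrite lee_fin.
  have -> : (fun e => \sum_(S : {set 'I_p} | (thr < (#|S|%:R)%:E)%E) (w S)%:E * K S e)%E =
      (fun e => \sum_(S : {set 'I_p}) (if (thr < (#|S|%:R)%:E)%E then (w S)%:E * K S e else 0))%E.
    by apply/funext => e; rewrite [LHS]big_mkcond.
  rewrite iterInt_sum; last 2 first.
  - by move=> S e; case: ifP => // _; rewrite mule_ge0// lee_fin.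
  - by move=> S; case: (thr < _)%E => // dd V be pb; exact: measurable_cst.
  rewrite [leRHS](_ : _ = (\sum_(S : {set 'I_p} | (thr < (#|S|%:R)%:E)%E)
      (w S * (expR (r - lam * (\sum_i `|bs i 0|)) * 4 ^+ #|S|))%:E)%E); last by rewrite sumEFin.
  rewrite [leRHS]big_mkcond/=; apply: lee_sum => S _; case: ifP => _; last by rewrite iterInt0.
  rewrite iterIntZl ?lee_fin// [leRHS]EFinM; apply: lee_wpmul2l; first by rewrite lee_fin.
  exact: iterInt_slab_tilt_le.
Qed.

End PosteriorBound.

(** * Dimension prior and asymptotics *)

Section Numerics.
Variable R : realType.

(** There are [C(p, k)] slabs of dimension [k], which cancels the uniform weight. *)
Lemma sum_by_card p (Q : pred nat) (h : nat -> R) :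
  \sum_(S : {set 'I_p} | Q #|S|) h #|S| / ('C(p, #|S|))%:R = \sum_(k < p.+1 | Q k) h k.
Proof.
have cS (S : {set 'I_p}) : (#|S| < p.+1)%N by rewrite ltnS -[X in (_ <= X)%N]card_ord max_card.
rewrite (partition_big (fun S : {set 'I_p} => Ordinal (cS S)) (fun k : 'I_p.+1 => Q k))//=.
apply: eq_bigr => k Qk.
rewrite (eq_bigl (fun S : {set 'I_p} => #|S| == k)); last first.
  move=> S; rewrite -val_eqE /=; case: eqP => [->|_]; last by rewrite andbF.
  by rewrite Qk.
rewrite (eq_bigr (fun=> h k / ('C(p, k))%:R)); last by move=> S /eqP ->.
rewrite sumr_const -[X in _ *+ X]/(#|[pred S : {set 'I_p} | #|S| == k]|).
have -> : #|[pred S : {set 'I_p} | #|S| == k]| = 'C(p, k).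
  by have := card_draws 'I_p k; rewrite card_ord => <-; apply: eq_card => S; rewrite !inE.
by rewrite -[LHS]mulr_natr divfK// pnatr_eq0 -lt0n bin_gt0 -ltnS.
Qed.

Lemma geometric_tail (q : R) (s N : nat) : 0 <= q -> q <= 1 / 2 ->
  \sum_(k < N | (s < k)%N) q ^+ (k - s) <= 2 * q.
Proof.
move=> q0 q2; set T := \sum_(k < N | _) _.
(* Telescoped form of the sum; [maxn] covers the case where no index below [N] exceeds [s]. *)
have H : (1 - q) * T + q ^+ (maxn N s.+1 - s) = q.
  rewrite /T; elim: N {T} => [|N IH].
    by rewrite big_ord0 mulr0 add0r max0n subSnn expr1.
  rewrite big_mkcond big_ord_recr/= -big_mkcond/=.
  have [sN|Ns] := ltnP s N.
    have eN : maxn N s.+1 = N by apply/maxn_idPl.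
    have eN1 : maxn N.+1 s.+1 = N.+1 by apply/maxn_idPl; exact: leqW.
    by rewrite -[RHS]IH eN eN1 subSn 1?ltnW// exprS; ring.
  rewrite addr0 -[RHS]IH; congr (_ + q ^+ (_ - s)).
  have -> : maxn N.+1 s.+1 = s.+1 by apply/maxn_idPr.
  by have -> : maxn N s.+1 = s.+1 by apply/maxn_idPr; exact: leqW.
have T0 : 0 <= T by apply: sumr_ge0 => k _; exact: exprn_ge0.
have := exprn_ge0 (maxn N s.+1 - s) q0; nra.
Qed.

Lemma expR_ln_decay (c C d : R) : 0 < c -> 0 <= C -> 0 < d ->
  exists N, forall p, (N <= p)%N -> C * expR (- (c * ln p%:R)) <= d.
Proof.
move=> c0 C0 d0; exists (Num.bound (expR (C / d / c))) => p Np.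
have yp : expR (C / d / c) <= p%:R.
  rewrite (le_trans (ler_norm _))// (le_trans (ltW (archi_boundP _)))// ler_nat.
  by move: Np; rewrite ger0_norm// expR_ge0.
have y0 : 0 < p%:R :> R by rewrite (lt_le_trans _ yp) ?expR_gt0.
have hl : C / d / c <= ln p%:R.
  by rewrite -ler_expR lnK.
rewrite expRN ler_pdivrMr ?expR_gt0// mulrC -ler_pdivrMr//.
apply: le_trans (expR_ge1Dx _); rewrite ler_wpDl//.
by move: hl; rewrite ler_pdivrMr// [ln _ * _]mulrC.
Qed.

Lemma expect_set0 n p (X : 'M[R]_(n, p)) (lam : R) (pi : nat -> R) b0 :
  expect X b0 (posterior X lam pi set0) = 0%E.
Proof.
rewrite /expect /intRm -[RHS](@iterInt0 R n (enum 'I_n) 0).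
congr iterInt; apply/funext => e; rewrite /posterior.
set N := prior_int _ _ _; suff -> : N = 0%E by rewrite !mul0e.
rewrite /N /prior_int big1// => S _; rewrite -[RHS](mule0 (pi #|S| / 'C(p, #|S|)%:R)%:E).
congr (_ * _)%E; rewrite -[RHS](@iterInt0 R p (enum S) 0).
by congr iterInt; apply/funext => b; rewrite indicE in_set0 !mul0e.
Qed.

Lemma prior_ratio (p : nat) (pi : nat -> R) (c : R) (s k : nat) :
  0 <= c -> (forall s, (1 <= s <= p)%N -> pi s <= c * pi s.-1) ->
  (s <= k <= p)%N -> pi k <= c ^+ (k - s) * pi s.
Proof.
move=> c0 hc /andP[sk kp]; rewrite -{1}(subnK sk).
have : (k - s + s <= p)%N by rewrite subnK.
elim: (k - s)%N => [|m IH] mp; first by rewrite add0n expr0 mul1r.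
rewrite addSn exprS -mulrA; apply: (le_trans (hc _ _)); first by rewrite -addSn mp andbT addSn.
by rewrite ler_wpM2l// IH// (leq_trans _ mp)// addSn.
Qed.

Lemma prior_pos (p : nat) (pi : nat -> R) (c c' : R) (s : nat) :
  0 < c' -> (forall s, (s <= p)%N -> 0 <= pi s) -> \sum_(s < p.+1) pi s = 1 ->
  (forall s, (1 <= s <= p)%N -> c' * pi s.-1 <= pi s /\ pi s <= c * pi s.-1) ->
  (s <= p)%N -> 0 < pi s.
Proof.
move=> c0 pi0 sum1 hc; elim: s => [_|s IH sp].
  rewrite lt_def pi0// andbT; apply/eqP => p0.
  suff z k : (k <= p)%N -> pi k = 0.
    have := sum1; rewrite big1 => [/esym/eqP|k _]; first by rewrite oner_eq0.
    by apply: z; rewrite -ltnS.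
  elim: k => // k IHk kp; apply/eqP; rewrite eq_le pi0// andbT.
  by have [_] := hc k.+1 kp; rewrite /= IHk ?mulr0// ltnW.
have [h _] := hc s.+1 sp; apply: lt_le_trans h.
by rewrite mulr_gt0//= IH// ltnW.
Qed.

Lemma third_term_le (p s : nat) (pi : nat -> R) (A2 A4 M a f L D2 eta : R) (Q : pred nat) :
  (s <= p)%N -> 0 < pi s -> 0 < A2 -> 0 < A4 -> 2 < M -> 0 <= a <= 1 ->
  0 <= f -> 0 <= L -> 0 <= D2 -> 0 < eta ->
  (forall k, (s <= k <= p)%N -> pi k <= (A2 * expR (- (A4 * L))) ^+ (k - s) * pi s) ->
  (forall k, Q k -> (s < k)%N /\
     M * (s%:R * L + 32 * a * s%:R * f * L + D2) <= A4 * (k%:R - s%:R) * L) ->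
  4 * A2 * expR (- ((M - 2) / (2 * M) * A4 * L)) <= 1 / 2 ->
  8 * A2 * expR (3 / 2) * expR (- ((M - 2) / (2 * M) * A4 * L)) <= eta ^+ 2 ->
  8 * expR 1 * expR (- ((M - 2) / 2 * L)) <= 1 ->
  expR D2 / eta * (expR (3 / 2) * (2 * expR 1 * expR (2 * L)) ^+ s)
    * (expR (a * (49 * s%:R * L * f + D2)) * \sum_(k < p.+1 | Q k) (pi k / pi s) * 4 ^+ k)
  <= eta.
Proof.
move=> sp pis A20 A40 M2 /andP[a0 a1] f0 L0 D20 eta0 hpi hQ h1 h2 h3.
(* The fraction [nu] of the decay [p ^ (- A4)] makes the sum over dimensions
   geometric; the remaining [(1 - nu) M = (M + 2) / 2 > 2] is enough for the rest. *)
set nu := (M - 2) / (2 * M) in h1 h2.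
have M0 : 0 < M by lra.
have nu0 : 0 <= nu by rewrite divr_ge0//; lra.
have nuM : (1 - nu) * M = (M + 2) / 2 by rewrite /nu; field; rewrite gt_eqF.
set q := 4 * A2 * expR (- (nu * A4 * L)) in h1.
have q0 : 0 <= q by rewrite !mulr_ge0 ?expR_ge0// ltW.
set E0 := s%:R * L + 32 * a * s%:R * f * L + D2 in hQ.
set z := expR (- ((M + 2) / 2 * E0)).
have hk k : (k < p.+1)%N -> Q k -> pi k / pi s * 4 ^+ k <= 4 ^+ s * z * q ^+ (k - s).
  move=> kp Qk; have [sk hA] := hQ k Qk.
  have skp : (s <= k <= p)%N by rewrite (ltnW sk) -ltnS.
  apply: (@le_trans _ _ ((A2 * expR (- (A4 * L))) ^+ (k - s) * 4 ^+ k)).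
    by rewrite ler_wpM2r ?exprn_ge0// ler_pdivrMr// hpi.
  have e4 : 4 ^+ k = 4 ^+ s * 4 ^+ (k - s) :> R by rewrite -exprD subnKC// ltnW.
  have -> : (A2 * expR (- (A4 * L))) ^+ (k - s) * 4 ^+ k =
      4 ^+ s * (q ^+ (k - s) * expR (- ((1 - nu) * (A4 * (k%:R - s%:R) * L)))).
    rewrite e4 /q.
    have -> : - ((1 - nu) * (A4 * (k%:R - s%:R) * L)) = (k - s)%:R * (- ((1 - nu) * A4 * L)).
      by rewrite natrB ?(ltnW sk)//; ring.
    rewrite expRM_natl -exprMn.
    have -> : 4 * A2 * expR (- (nu * A4 * L)) * expR (- ((1 - nu) * A4 * L)) =
       4 * (A2 * expR (- (A4 * L))).
      by rewrite -mulrA -expRD -mulrA; congr (_ * (_ * expR _)); ring.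
    by rewrite [in RHS]exprMn; ring.
  rewrite -[leRHS]mulrA ler_wpM2l ?exprn_ge0// [leLHS]mulrC ler_wpM2r ?exprn_ge0//.
  rewrite /z -nuM ler_expR lerN2 -[leLHS]mulrA ler_wpM2l//.
  rewrite subr_ge0 /nu ler_pdivrMr ?mulr_gt0//; lra.
have hsum : \sum_(k < p.+1 | Q k) (pi k / pi s) * 4 ^+ k <= 4 ^+ s * z * (2 * q).
  apply: (@le_trans _ _ (\sum_(k < p.+1 | Q k) 4 ^+ s * z * q ^+ (k - s))).
    by apply: ler_sum => k Qk; apply: hk.
  rewrite -mulr_sumr ler_wpM2l ?mulr_ge0 ?expR_ge0 ?exprn_ge0//.
  apply: le_trans (geometric_tail s p.+1 q0 h1).
  rewrite [leLHS]big_mkcond [leRHS]big_mkcond/=; apply: ler_sum => k _.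
  case: ifPn => [/hQ[-> _]//|_]; by case: ifP => // _; rewrite exprn_ge0.
set W := expR D2 / eta * _.
have W0 : 0 <= W by rewrite !mulr_ge0 ?expR_ge0 ?invr_ge0 ?exprn_ge0 ?mulr_ge0 ?expR_ge0// ltW.
set r := a * _.
apply: (@le_trans _ _ (W * (expR r * (4 ^+ s * z * (2 * q))))).
  by rewrite !ler_wpM2l ?expR_ge0.
have -> : W * (expR r * (4 ^+ s * z * (2 * q))) =
  2 * q * expR (3 / 2) / eta *
   ((8 * expR 1) ^+ s * (expR (2 * L) ^+ s * expR D2 * expR r * z)).
  have -> : 8 = 2 * 4 :> R by ring.
  by rewrite /W !exprMn; ring.
have hz : (8 * expR 1) ^+ s * (expR (2 * L) ^+ s * expR D2 * expR r * z) <= 1.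
  apply: (@le_trans _ _ ((8 * expR 1 * expR (- ((M - 2) / 2 * L))) ^+ s)); last first.
    by rewrite exprn_ile1// !mulr_ge0 ?expR_ge0.
  rewrite [leRHS]exprMn ler_wpM2l ?exprn_ge0 ?mulr_ge0 ?expR_ge0//.
  rewrite -!expRM_natl /z -!expRD ler_expR /r /E0.
  set sr := s%:R; have sr0 : 0 <= sr :> R by [].
  have P1 : 0 <= sr * L by rewrite mulr_ge0.
  have P2 : 0 <= a * sr * f * L by rewrite !mulr_ge0.
  have P3 : a * D2 <= D2 by rewrite ler_piMl.
  have P4 : 2 * (a * sr * f * L) <= M * (a * sr * f * L) by rewrite ler_wpM2r// ltW.
  have P5 : 2 * D2 <= M * D2 by rewrite ler_wpM2r// ltW.
  by nra.
have hq : 2 * q * expR (3 / 2) / eta <= eta.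
  rewrite ler_pdivrMr// -expr2; apply: le_trans h2; rewrite /q.
  by rewrite le_eqVlt; apply/orP; left; apply/eqP; ring.
rewrite -[leRHS]mulr1; apply: ler_pM => //.
- by rewrite divr_ge0 ?(ltW eta0)// mulr_ge0 ?expR_ge0// mulr_ge0.
- by rewrite !mulr_ge0 ?exprn_ge0 ?mulr_ge0 ?expR_ge0 ?exprn_ge0 ?expR_ge0.
Qed.

End Numerics.

Section Assembly.
Variable R : realType.

Lemma event_threshold n p (X : 'M[R]_(n, p)) (lam M A4 : R) (b0 bs : 'cV[R]_p) :
  0 < lam -> 0 < lambar X -> 0 < colnorm X -> 0 < M -> 0 < A4 ->
  event X lam M A4 b0 bs = set0 \/
  exists2 f, 0 <= f &
    (forall x, l1on (~: supp bs) x <= 7 * l1on (supp bs) x ->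
      (colnorm X * l1on (supp bs) x) ^+ 2 <= f * #|supp bs|%:R * sqnorm2 (X *m x)) /\
    event X lam M A4 b0 bs = [set b |
      ((#|supp bs|%:R + M / A4 * #|supp bs|%:R * (1 + 16 * (lam / lambar X) * f)
        + M / A4 * sqnorm2 (X *m (b0 - bs)) / ln p%:R)%:E < (#|supp b|%:R)%:E)%E].
Proof.
move=> lam0 lb0 c0 M0 A40; rewrite /event.
have [s0|s0] := eqVneq #|supp bs| 0%N.
  right; exists 0 => //; split.
    move=> x _; have -> : l1on (supp bs) x = 0.
      by move/eqP: s0; rewrite cards_eq0 => /eqP s0; rewrite /l1on s0 big_set0.
    by rewrite mulr0 expr0n/= !mul0r.
  by apply/seteqP; split => b /=; rewrite s0 mulr0 mul0e mul0r !addr0 !add0e add0r.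
have s0' : 0 < #|supp bs|%:R :> R by rewrite ltr0n lt0n.
have lb16 : 0 < 16 * (lam / lambar X) by rewrite mulr_gt0// divr_gt0.
case fE : (phi_inv2 (phiS X (supp bs))) => [f| |].
- right; exists f.
    case: (phiS X (supp bs)) fE => [r| |]//=; last by case=> <-.
    by case: ifPn => // _ [<-]; rewrite invr_ge0 sqr_ge0.
  by split=> // x; exact: compat_phi.
- left; apply/seteqP; split => b //=.
  rewrite gt0_muley ?lte_fin// addey// gt0_muley ?lte_fin ?mulr_gt0 ?divr_gt0 ?invr_gt0//.
- by move: fE; rewrite /phi_inv2; case: (phiS X (supp bs)) => [r| |]; [case: (r == 0)| |].
Qed.

Lemma expect_event_le n p (X : 'M[R]_(n, p)) (lam A2 A4 M c' eta : R) (pi : nat -> R)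
    (b0 bs : 'cV[R]_p) :
  (1 < p)%N -> (forall s, (s <= p)%N -> 0 <= pi s) -> \sum_(s < p.+1) pi s = 1 ->
  0 < lam -> colnorm X / p%:R <= lam <= 2 * lambar X ->
  0 < c' -> 0 < A2 -> 0 < A4 ->
  (forall s, (1 <= s <= p)%N ->
    c' * pi s.-1 <= pi s /\ pi s <= A2 * expR (- (A4 * ln p%:R)) * pi s.-1) ->
  2 < M -> 0 < eta ->
  2 * expR (- (1 * ln p%:R)) <= eta ->
  4 * A2 * expR (- ((M - 2) / (2 * M) * A4 * ln p%:R)) <= 1 / 2 ->
  8 * A2 * expR (3 / 2) * expR (- ((M - 2) / (2 * M) * A4 * ln p%:R)) <= eta ^+ 2 ->
  8 * expR 1 * expR (- ((M - 2) / 2 * ln p%:R)) <= 1 ->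
  (expect X b0 (posterior X lam pi (event X lam M A4 b0 bs)) <= (3 * eta)%:E)%E.
Proof.
move=> p1 pi0 sum1 lam0 /andP[lam1 lam2] c'0 A20 A40 hpi M2 eta0 h0 h1 h2 h3.
have p0 : (0 < p)%N by exact: ltnW.
have y1 : 1 < p%:R :> R by rewrite ltr1n.
have y0 : 0 < p%:R :> R by exact: lt_trans y1.
set L := ln p%:R in hpi h0 h1 h2 h3 *.
have L0 : 0 < L by exact: ln_gt0.
have M0 : 0 < M by exact: lt_trans M2.
have lb0 : 0 < lambar X.
  by have := lt_le_trans lam0 lam2; rewrite pmulr_rgt0.
have c0 : 0 < colnorm X.
  rewrite lt_def colnorm_ge0 andbT; apply: contraTneq lb0 => c0.
  by rewrite /lambar c0 mulr0 mul0r ltxx.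
have [->|[f f0 [compat ->]]] := event_threshold b0 bs lam0 lb0 c0 M0 A40.
  by rewrite expect_set0 lee_fin mulr_ge0 ?ltW.
set s := #|supp bs| in compat *; set d := X *m (b0 - bs).
have sp : (s <= p)%N by rewrite -[X in (_ <= X)%N]card_ord max_card.
have pis : 0 < pi s by exact: (prior_pos c'0 pi0 sum1 hpi).
pose u := Num.sqrt L.
have u2 : u ^+ 2 = L by rewrite sqr_sqrtr// ltW.
have lbE : lambar X = 2 * colnorm X * u by [].
pose a := lam / (2 * lambar X).
have lb20 : 0 < 2 * lambar X by rewrite pmulr_rgt0.
have a0 : 0 <= a by rewrite divr_ge0// ltW.
have a1 : a <= 1 by rewrite ler_pdivrMr// mul1r.
have alb : a * lambar X = lam / 2 by rewrite /a; field; rewrite gt_eqF.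
have lamE : lam = 4 * a * colnorm X * u.
  have -> : lam = 2 * (a * lambar X) by rewrite alb; field.
  by rewrite lbE; ring.
have lla : 16 * (lam / lambar X) = 32 * a by rewrite /a; field; rewrite gt_eqF.
have D20 := sqnorm2_ge0 d.
pose r := a * (49 * s%:R * L * f + sqnorm2 d).
have hexp (b : 'cV[R]_p) : lam * (\sum_i `|bs i 0|) - lam * (\sum_i `|b i 0|)
    + lam / 2 * (\sum_i `|(b - bs) i 0|)
    + a * dot d (X *m (b - bs)) - sqnorm2 (X *m (b - bs)) / 2
    + (1 - a) ^+ 2 * sqnorm2 (X *m (b - bs)) / 2
    <= - (lam / 4 * (\sum_i `|(b - bs) i 0|)) + r.
  have aa : 0 <= a <= 1 by rewrite a0.
  have := exponent_bound d (ltW lam0) aa (sqrtr_ge0 L) lamE f0 (compat (b - bs)).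
  by rewrite u2.
set l1 := \sum_i `|bs i 0| in hexp.
pose L0' := pi s * expR (- 3 / 2) * ((2 * expR 1 * p%:R ^+ 2)^-1) ^+ s * expR (- (lam * l1)).
have z0 : 0 < 2 * expR 1 * p%:R ^+ 2 :> R by rewrite !mulr_gt0 ?expR_gt0 ?exprn_gt0.
have L0'0 : 0 < L0'.
  by rewrite !mulr_gt0 ?expR_gt0// exprn_gt0// invr_gt0.
have kap0 : 0 < expR (sqnorm2 d) / eta by rewrite divr_gt0 ?expR_gt0.
set thr : R := s%:R + _ + _.
have Bthr (b : 'cV[R]_p) : [set b : 'cV[R]_p | (thr%:E < (#|supp b|%:R)%:E)%E] b ->
  (thr%:E < (#|supp b|%:R)%:E)%E by [].
have evid Y := @evidence_ge R n p X Y bs lam pi lam0 p0 lam1 pi0.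
apply: (le_trans (expect_posterior_le lam0 c0 (ltW lb0) a0 alb pi0 Bthr L0'0 evid kap0 hexp)).
rewrite lee_fin -/d.
have -> : 3 * eta = eta + eta + eta by ring.
have pE : p%:R = expR L by rewrite lnK.
apply: lerD; first apply: lerD.
- have -> : lambar X ^+ 2 / (2 * colnorm X ^+ 2) = 2 * L.
    by rewrite lbE -u2; field; rewrite gt_eqF.
  apply: le_trans h0; rewrite [_ * 2]mulrC -[leLHS]mulrA ler_wpM2l// pE -expRD ler_expR.
  by lra.
- by rewrite invf_div divfK// gt_eqF ?expR_gt0.
under eq_bigl do rewrite lte_fin.
set g : nat -> R := fun k => pi k * (expR (r - lam * l1) * 4 ^+ k).
rewrite (eq_bigr (fun S : {set 'I_p} => g #|S| / ('C(p, #|S|))%:R)); last first.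
  by move=> S _; rewrite /g; ring.
rewrite (sum_by_card p (fun k => thr < k%:R) g).
have -> : \sum_(k < p.+1 | thr < k%:R) g k =
   pi s * expR (- (lam * l1)) * (expR r * \sum_(k < p.+1 | thr < k%:R) (pi k / pi s) * 4 ^+ k).
  rewrite [RHS]mulrA [RHS]mulr_sumr; apply: eq_bigr => k _.
  rewrite /g expRD; move: (expR r) (expR (- (lam * l1))) (4 ^+ k) => x y z.
  by field; rewrite gt_eqF.
set Sg := \sum_(k < _ | _) _.
have -> : expR (sqnorm2 d) / eta / L0' * (pi s * expR (- (lam * l1)) * (expR r * Sg)) =
  expR (sqnorm2 d) / eta * (expR (3 / 2) * (2 * expR 1 * expR (2 * L)) ^+ s) * (expR r * Sg).
  have -> : expR (2 * L) = p%:R ^+ 2 by rewrite expRM_natl -pE.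
  have e32 : expR (- 3 / 2) = (expR (3 / 2))^-1 :> R by rewrite -expRN mulNr.
  rewrite /L0' e32 exprVn.
  have := exprn_gt0 s z0; move: (_ ^+ s) => Z Z0.
  have := expR_gt0 (- (lam * l1)); move: (expR (- (lam * l1))) => E E0.
  have := expR_gt0 (3 / 2 : R); move: (expR (3 / 2)) => F F0.
  by move: (expR r) => G; field; rewrite !gt_eqF.
apply: (third_term_le (M := M) (A2 := A2) (A4 := A4) (Q := fun k => thr < k%:R)) => //.
- by rewrite a0.
- exact: ltW.
- move=> k; apply: prior_ratio; first by rewrite mulr_ge0 ?expR_ge0// ltW.
  by move=> i hi; have [] := hpi i hi.
move=> k; rewrite /thr lla => hk.
have MA : 0 < M / A4 by rewrite divr_gt0.
have sr0 : 0 <= s%:R :> R by [].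
have g1 : 0 <= M / A4 * s%:R * (1 + 32 * a * f).
  apply: mulr_ge0; first by apply: mulr_ge0 => //; exact: ltW.
  by apply: addr_ge0 => //; apply: mulr_ge0 => //; exact: mulr_ge0.
have g2 : 0 <= M / A4 * sqnorm2 d / L.
  by rewrite divr_ge0 ?(ltW L0)// mulr_ge0// ltW.
split.
  by rewrite -(ltr_nat R); apply: le_lt_trans hk; rewrite -addrA lerDl addr_ge0.
have -> : M * (s%:R * L + 32 * a * s%:R * f * L + sqnorm2 d) =
  A4 * (M / A4 * s%:R * (1 + 32 * a * f) + M / A4 * sqnorm2 d / L) * L.
  by field; rewrite !gt_eqF.
rewrite ler_wpM2r ?(ltW L0)// ler_wpM2l ?(ltW A40)//.
by rewrite lerBrDl addrA ltW.
Qed.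

End Assembly.

Unset Implicit Arguments.

Theorem theorem10 (R : realType)
  (n p : nat -> nat) (X : forall k, 'M[R]_(n k, p k)) (lam : nat -> R)
  (pi : nat -> nat -> R) (A1 A2 A3 A4 M : R) :
  (forall N, exists K, forall k, (K <= k)%N -> (N <= n k)%N /\ (N <= p k)%N) ->
  (forall k s, (s <= p k)%N -> 0 <= pi k s) ->
  (forall k, \sum_(s < (p k).+1) pi k s = 1) ->
  (forall k, 0 < lam k) ->
  (forall k, colnorm (X k) / (p k)%:R <= lam k <= 2 * lambar (X k)) ->
  0 < A1 -> 0 < A2 -> 0 < A3 -> 0 < A4 ->
  (forall k s, (1 <= s <= p k)%N ->
     A1 * ((p k)%:R `^ (- A3)) * pi k s.-1 <= pi k s /\
     pi k s <= A2 * ((p k)%:R `^ (- A4)) * pi k s.-1) ->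
  2 < M ->
  forall eps : R, 0 < eps -> exists K, forall k, (K <= k)%N ->
    (ereal_sup [set expect (X k) b0
                   (posterior (X k) (lam k) (pi k) (event (X k) (lam k) M A4 b0 bs))
               | b0 in [set: 'cV[R]_(p k)] & bs in [set: 'cV[R]_(p k)]]
      <= eps%:E)%E.
Proof.
move=> np pi0 sum1 lam0 lamb A10 A20 A30 A40 hpi M2 eps eps0.
have eta0 : 0 < eps / 3 by rewrite divr_gt0.
have nu0 : 0 < (M - 2) / (2 * M) * A4.
  by rewrite mulr_gt0// divr_gt0 ?subr_gt0// mulr_gt0// (lt_trans _ M2).
have [N0 h0] := @expR_ln_decay R 1 2 _ ltr01 (ler0n _ _) eta0.
have half0 : 0 < 1 / 2 :> R by rewrite divr_gt0.
have C1 : 0 <= 4 * A2 by rewrite mulr_ge0// ltW.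
have [N1 h1] := expR_ln_decay nu0 C1 half0.
have C2 : 0 <= 8 * A2 * expR (3 / 2) by rewrite !mulr_ge0 ?expR_ge0// ltW.
have [N2 h2] := expR_ln_decay nu0 C2 (exprn_gt0 2 eta0).
have M20 : 0 < (M - 2) / 2 by rewrite divr_gt0// subr_gt0.
have C3 : 0 <= 8 * expR 1 :> R by rewrite mulr_ge0// expR_ge0.
have [N3 h3] := expR_ln_decay M20 C3 ltr01.
have [K hK] := np (maxn 2 (maxn (maxn N0 N1) (maxn N2 N3))).
exists K => k Kk; have [_] := hK k Kk.
rewrite !geq_max => /andP[p2 /andP[/andP[p0 p1] /andP[p3 p4]]].
apply: ge_ereal_sup => _ [b0 _ [bs _ <-]].
have -> : eps = 3 * (eps / 3) by field.
have p_neq0 : (p k)%:R != 0 :> R by rewrite pnatr_eq0 -lt0n (leq_trans _ p2).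
have c'0 : 0 < A1 * (p k)%:R `^ (- A3).
  by rewrite mulr_gt0// powR_gt0// lt_def p_neq0/=.
apply: (expect_event_le (c' := A1 * (p k)%:R `^ (- A3)) (A2 := A2)) => //.
- exact: pi0.
- move=> i hi; have [x1 x2] := hpi k i hi; split => //.
  by move: x2; rewrite /powR (negPf p_neq0) mulNr.
- exact: h0.
- exact: h1.
- exact: h2.
- exact: h3.
Qed.
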